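(* Let $(M,G)$ be a generalized Riemannian manifold with associated endomorphism $\phi$, and let $E$ be a $g$-isotropic subbundle of $\mathbf{T}M$. Then there exists a bijection, given by $\tau\mapsto\lambda=\tau\circ\phi|_E$, between the set of generalized, metric, 2-nilpotent structures $\tau$ (i.e., generalized 2-nilpotent structures compatible with $G$) with $\mathrm{im}\,\tau=E$ and the set of complex structures $\lambda$ on the vector bundle $E$ that are compatible with $G|_E$. Moreover, the structure $\tau$ is integrable if and only if $E$ is closed by Courant brackets and $(G|_E,\lambda)$ is an almost Kähler structure on the Lie algebroid $E$.
   Context: $M$ is a smooth manifold, $\mathbf{T}M=TM\oplus T^*M$, with neutral metric $g((X,\alpha),(Y,\mu))=\alpha(Y)+\mu(X)$ and Courant bracket $[(X,\alpha),(Y,\mu)]=([X,Y],L_X\mu-L_Y\alpha+\frac12 d(\alpha(Y)-\mu(X)))$. A generalized Riemannian metric on $M$ is a positive definite metric $G$ on $\mathbf{T}M$ of the form $G(\mathcal X,\mathcal Y)=g(\phi\mathcal X,\mathcal Y)$ with $\phi\in End(\mathbf{T}M)$, $\phi^2=Id$, $g(\phi\mathcal X,\phi\mathcal Y)=g(\mathcal X,\mathcal Y)$. A generalized 2-nilpotent structure is an endomorphism $\tau\in End(\mathbf{T}M)$ of constant rank with $\tau^2=0$ and $g(\mathcal X,\tau\mathcal Y)+g(\tau\mathcal X,\mathcal Y)=0$; then $E=\mathrm{im}\,\tau$ is $g$-isotropic, $\ker\tau=E^{\perp_g}$, and $\tau|_{\phi(E)}:\phi(E)\to E$ is an isomorphism.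 $\tau$ is compatible with $G$ if $G(\tau\mathcal X,\tau\mathcal Y)=G(\mathcal X,\mathcal Y)$ for all $\mathcal X,\mathcal Y\in\phi(E)$; then $(G,\tau)$ is called a generalized, metric, 2-nilpotent structure. $\tau$ is integrable if $\mathcal N_\tau(\mathcal X,\mathcal Y)=[\tau\mathcal X,\tau\mathcal Y]-\tau[\mathcal X,\tau\mathcal Y]-\tau[\tau\mathcal X,\mathcal Y]+\tau^2[\mathcal X,\mathcal Y]$ vanishes identically. A complex structure on the vector bundle $E$ is $\lambda\in End(E)$ with $\lambda^2=-Id$; it is compatible with $G|_E$ if $G(\lambda e_1,\lambda e_2)=G(e_1,e_2)$. If $E$ is $g$-isotropic and $\Gamma E$ is closed under Courant brackets, $E$ is a Lie algebroid with the Courant bracket and anchor $pr_{TM}|_E$, with exterior differential $d_E$. The terminology for Lie algebroids is the same as for manifolds: $(G|_E,\lambda)$ is an almost Kähler structure on the Lie algebroid $E$ if $\lambda$ is a complex structure on the vector bundle $E$ compatible with $G|_E$ and the fundamental $2$-form $\omega_E\in\Gamma\wedge^2E^*$, determined by $G(e_1,e_2)=\omega_E(e_1,\lambda e_2)$, satisfies $d_E\omega_E=0$. *)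

(* Defs.v *)
From HB Require Import structures.
From mathcomp Require Import all_boot all_order all_algebra.
From mathcomp Require Import all_classical all_reals all_analysis.

Set Implicit Arguments.
Unset Strict Implicit.
Unset Printing Implicit Defensive.

Import Order.TTheory GRing.Theory Num.Theory.
Import numFieldNormedType.Exports.

Local Open Scope classical_set_scope.
Local Open Scope ring_scope.

Section Manifolds.
Variables (R : realType) (n : nat).

(* U is meant to be open: all iterated partial derivatives of f exist and are
   Frechet differentiable at the points of U. *)
Definition smooth_on (U : set 'rV[R]_n) (f : 'rV[R]_n -> R) : Prop :=
  forall (s : seq 'I_n) (x : 'rV[R]_n), U x ->
    differentiable
      (foldr (fun i (h : 'rV[R]_n -> R) => 'D_(delta_mx 0 i) h) f s) x.

(* The values of [chart_map] outside [chart_dom], and of [chart_inv] outside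
   the image of the chart, are irrelevant. *)
Record chart (M : topologicalType) := Chart {
  chart_map :> M -> 'rV[R]_n;
  chart_inv : 'rV[R]_n -> M;
  chart_dom : set M;
  chart_dom_open : open chart_dom;
  chart_img_open : open (chart_map @` chart_dom);
  chart_mapK : forall p, chart_dom p -> chart_inv (chart_map p) = p;
  chart_map_continuous :
    forall p, chart_dom p -> {for p, continuous chart_map};
  chart_inv_continuous :
    forall p, chart_dom p -> {for chart_map p, continuous chart_inv}
}.

Record manifold := Manifold {
  carrier :> topologicalType;
  manifold_hausdorff : hausdorff_space carrier;
  manifold_second_countable : @second_countable carrier;
  atlas : set (chart carrier);
  atlas_cover : forall p : carrier, exists2 c, atlas c & chart_dom c p;
  atlas_compatible : forall c c' : chart carrier, atlas c -> atlas c' ->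
    forall j : 'I_n, smooth_on (c @` (chart_dom c `&` chart_dom c'))
      (fun x => c' (chart_inv c x) 0 j)
}.

Definition chart_at (M : manifold) (p : M) : chart M :=
  s2val (cid2 (atlas_cover p)).

End Manifolds.

(* The tangent space T_pM is 'rV[R]_n, a vector being given by its components
   in the chart [chart_at p]; likewise T_p^*M is 'rV[R]_n, a covector being
   given by its components in the dual coordinate basis. *)
Notation tangent R n := 'rV[R]_n.
Notation cotangent R n := 'rV[R]_n.
(* the fibre of TM (+) T^*M *)
Notation fiber R n := (tangent R n * cotangent R n)%type.

Section Tensors.
Variables (R : realType) (n : nat) (M : manifold R n).

Definition pairing (a : cotangent R n) (v : tangent R n) : R :=
  \sum_(j < n) a 0 j * v 0 j.

(* the derivative v(f) of f : M -> R along v in T_pM *)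
Definition dirD (p : M) (v : tangent R n) (f : M -> R) : R :=
  'D_v (f \o chart_inv (chart_at p)) (chart_at p p).

(* the components dc_p(v) of v in T_pM in an arbitrary chart c at p *)
Definition tcomp (c : chart R n M) (p : M) (v : tangent R n) : 'rV[R]_n :=
  'D_v (c \o chart_inv (chart_at p)) (chart_at p p).

(* the j-th coordinate vector of the chart c at p, as an element of T_pM *)
Definition cframe (c : chart R n M) (p : M) (j : 'I_n) : tangent R n :=
  'D_(delta_mx 0 j) (chart_at p \o chart_inv c) (c p).

(* local representatives in the chart c of a vector field and of a 1-form *)
Definition vrep (c : chart R n M) (X : M -> tangent R n) : 'rV[R]_n -> 'rV[R]_n :=
  fun x => tcomp c (chart_inv c x) (X (chart_inv c x)).
Definition frep (c : chart R n M) (mu : M -> cotangent R n) :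
    'rV[R]_n -> 'rV[R]_n :=
  fun x => \row_j pairing (mu (chart_inv c x)) (cframe c (chart_inv c x) j).

Definition smooth_fun (U : set M) (f : M -> R) : Prop :=
  forall c, atlas c -> smooth_on (c @` (U `&` chart_dom c)) (f \o chart_inv c).

Definition smooth_vf (U : set M) (X : M -> tangent R n) : Prop :=
  forall c, atlas c -> forall j : 'I_n,
    smooth_on (c @` (U `&` chart_dom c)) (fun x => vrep c X x 0 j).

Definition smooth_form (U : set M) (mu : M -> cotangent R n) : Prop :=
  forall c, atlas c -> forall j : 'I_n,
    smooth_on (c @` (U `&` chart_dom c)) (fun x => frep c mu x 0 j).

Definition smooth_sec (U : set M) (s : M -> fiber R n) : Prop :=
  smooth_vf U (fun p => (s p).1) /\ smooth_form U (fun p => (s p).2).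

(* The next three operations are the classical coordinate formulas, used at p
   in the chart [chart_at p]:
     [X,Y]^i = X^k d_k Y^i - Y^k d_k X^i,
     (L_X mu)_j = X^k d_k mu_j + mu_k d_j X^k,
     (df)_j = d_j f. *)
Definition lie_bracket (X Y : M -> tangent R n) : M -> tangent R n := fun p =>
  let c := chart_at p in 'D_(X p) (vrep c Y) (c p) - 'D_(Y p) (vrep c X) (c p).

Definition lie_derivative (X : M -> tangent R n) (mu : M -> cotangent R n) :
    M -> cotangent R n := fun p =>
  let c := chart_at p in
  'D_(X p) (frep c mu) (c p)
    + \row_j pairing (mu p) ('D_(delta_mx 0 j) (vrep c X) (c p)).

Definition differential (f : M -> R) : M -> cotangent R n := fun p =>
  \row_j dirD p (delta_mx 0 j) f.

Definition courant (s t : M -> fiber R n) : M -> fiber R n := fun p =>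
  let X q := (s q).1 in let alpha q := (s q).2 in
  let Y q := (t q).1 in let mu q := (t q).2 in
  (lie_bracket X Y p,
   lie_derivative X mu p - lie_derivative Y alpha p
   + 2^-1 *: differential
               (fun q => pairing (alpha q) (Y q) - pairing (mu q) (X q)) p).

Definition neutral (x y : fiber R n) : R := pairing x.2 y.1 + pairing y.2 x.1.

Definition smooth_end (F : M -> 'End(fiber R n)) : Prop :=
  forall (U : set M) (s : M -> fiber R n),
    open U -> smooth_sec U s -> smooth_sec U (fun p => F p (s p)).

Record pos_def_metric (G : M -> fiber R n -> fiber R n -> R) : Prop := {
  metric_bilinear : forall p, bilinear_for *%R *%R (G p);
  metric_symmetric : forall p x y, G p x y = G p y x;
  metric_pos_def : forall p x, x != 0 -> 0 < G p x x;
  metric_smooth : forall (U : set M) (s t : M -> fiber R n), open U ->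
    smooth_sec U s -> smooth_sec U t -> smooth_fun U (fun p => G p (s p) (t p))
}.

Record gen_riemannian (G : M -> fiber R n -> fiber R n -> R)
    (phi : M -> 'End(fiber R n)) : Prop := {
  gen_metric : pos_def_metric G;
  gen_phi_smooth : smooth_end phi;
  gen_metricE : forall p x y, G p x y = neutral (phi p x) y;
  gen_phi_invol : forall p, (phi p \o phi p = \1)%VF;
  gen_phi_isom : forall p x y, neutral (phi p x) (phi p y) = neutral x y
}.

Definition subbundle (k : nat) (E : M -> {vspace fiber R n}) : Prop :=
  forall p, exists U : set M, [/\ open U, U p &
    exists e : 'I_k -> M -> fiber R n,
      (forall i, smooth_sec U (e i)) /\
      (forall q, U q -> basis_of (E q) [tuple e i q | i < k])].

Definition g_isotropic (E : M -> {vspace fiber R n}) : Prop :=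
  forall p x y, x \in E p -> y \in E p -> neutral x y = 0.

Record gen_2nilpotent (tau : M -> 'End(fiber R n)) : Prop := {
  tau_smooth : smooth_end tau;
  tau_rank : exists r, forall p, \dim (limg (tau p)) = r;
  tau_sqr0 : forall p, (tau p \o tau p = 0)%VF;
  tau_skew : forall p x y, neutral x (tau p y) + neutral (tau p x) y = 0
}.

Definition tau_compatible (G : M -> fiber R n -> fiber R n -> R)
    (phi tau : M -> 'End(fiber R n)) : Prop :=
  forall p x y, x \in (phi p @: limg (tau p))%VS ->
    y \in (phi p @: limg (tau p))%VS -> G p (tau p x) (tau p y) = G p x y.

Definition gen_metric_2nilpotent (G : M -> fiber R n -> fiber R n -> R)
    (phi tau : M -> 'End(fiber R n)) : Prop :=
  gen_2nilpotent tau /\ tau_compatible G phi tau.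

Definition nijenhuis (tau : M -> 'End(fiber R n)) (s t : M -> fiber R n) :
    M -> fiber R n := fun p =>
  let taus q := tau q (s q) in let taut q := tau q (t q) in
  courant taus taut p - tau p (courant s taut p) - tau p (courant taus t p)
  + tau p (tau p (courant s t p)).

Definition tau_integrable (tau : M -> 'End(fiber R n)) : Prop :=
  forall s t, smooth_sec setT s -> smooth_sec setT t ->
    forall p, nijenhuis tau s t p = 0.

Section OnSubbundle.
Variable E : M -> {vspace fiber R n}.

Definition secE := forall p : M, subvs_of (E p).

Definition smooth_secE (U : set M) (e : secE) : Prop :=
  smooth_sec U (fun p => vsval (e p)).

(* The Courant bracket of smooth sections is smooth, so lying in Gamma(E) is a
   pointwise condition. *)
Definition courant_closed : Prop :=
  forall e1 e2 : secE, smooth_secE setT e1 -> smooth_secE setT e2 ->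
    forall p, courant (fun q => vsval (e1 q)) (fun q => vsval (e2 q)) p \in E p.

(* The Lie algebroid operations of E; the projection [vsproj] acts as the
   identity as soon as E is closed under Courant brackets. *)
Definition bracketE (e1 e2 : secE) : secE := fun p =>
  vsproj (E p) (courant (fun q => vsval (e1 q)) (fun q => vsval (e2 q)) p).

Definition anchorE (e : secE) (f : M -> R) : M -> R := fun p =>
  dirD p (vsval (e p)).1 f.

Definition formE := forall p : M, subvs_of (E p) -> subvs_of (E p) -> R.

Record two_formE (w : formE) : Prop := {
  two_form_bilinear : forall p, bilinear_for *%R *%R (w p);
  two_form_alternating : forall p x, w p x x = 0;
  two_form_smooth : forall (U : set M) (e1 e2 : secE), open U ->
    smooth_secE U e1 -> smooth_secE U e2 ->
    smooth_fun U (fun p => w p (e1 p) (e2 p))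
}.

Definition d_E (w : formE) (e1 e2 e3 : secE) : M -> R := fun p =>
  let ev (a b : secE) q := w q (a q) (b q) in
  anchorE e1 (ev e2 e3) p + anchorE e2 (ev e3 e1) p + anchorE e3 (ev e1 e2) p
  - ev (bracketE e1 e2) e3 p - ev (bracketE e2 e3) e1 p
  - ev (bracketE e3 e1) e2 p.

Definition closedE (w : formE) : Prop :=
  forall e1 e2 e3 : secE,
    smooth_secE setT e1 -> smooth_secE setT e2 -> smooth_secE setT e3 ->
    forall p, d_E w e1 e2 e3 p = 0.

Definition endE := forall p : M, 'End(subvs_of (E p)).

Record complex_structure (lam : endE) : Prop := {
  complex_smooth : forall (U : set M) (e : secE), open U ->
    smooth_secE U e -> smooth_secE U (fun p => lam p (e p));
  complex_sqr : forall p, (lam p \o lam p = - \1)%VF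
}.

Definition lam_compatible (G : M -> fiber R n -> fiber R n -> R)
    (lam : endE) : Prop :=
  forall p (x y : subvs_of (E p)),
    G p (vsval (lam p x)) (vsval (lam p y)) = G p (vsval x) (vsval y).

Definition fundamental_form (G : M -> fiber R n -> fiber R n -> R)
    (lam : endE) (w : formE) : Prop :=
  two_formE w /\
  forall p (x y : subvs_of (E p)), G p (vsval x) (vsval y) = w p x (lam p y).

Definition almost_kahler (G : M -> fiber R n -> fiber R n -> R)
    (lam : endE) : Prop :=
  [/\ complex_structure lam, lam_compatible G lam &
      exists w, fundamental_form G lam w /\ closedE w].

(* tau o phi|_E; it takes its values in E when im tau = E, and then [vsproj]
   acts as the identity *)
Definition tau_phi_restrE (phi tau : M -> 'End(fiber R n)) : endE := fun p =>
  linfun (fun x : subvs_of (E p) => vsproj (E p) (tau p (phi p (vsval x)))).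

End OnSubbundle.

End Tensors.

(* Main.v *)
Require Import Defs.
From HB Require Import structures.
From mathcomp Require Import all_boot all_order all_algebra.
From mathcomp Require Import all_classical all_reals all_analysis.
From mathcomp Require Import ring lra.

(** Write g for the neutral metric and lam for tau \o phi on E. Since
    G x y = g (phi x) y, skewness of tau for g makes lam skew for G, and
    compatibility makes lam a G-isometry of E; a skew isometry squares to -1.
    Conversely G (tau x) z = - g x (lam z) for z in E ([metric_tau]), so lam
    determines tau. This equation can be solved for tau when lam is given: if P
    is the G-orthogonal projection onto E, then tau = lam \o P \o phi. The
    projection is smooth because, in a local frame of E, it is expressed by the
    inverse of the Gram matrix of the frame ([lam_tau_smooth]).

    The integrability statement rests on two identities. The fundamental form
    omega satisfies omega u (tau y) = g u y for u in E ([omega_tau]). The Courant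
    bracket satisfies, with pr the projection onto TM,
      pr(a) g(b,c) = g([a,b],c) + 1/2 pr(c) g(a,b)
                     + g(b,[a,c]) + 1/2 pr(b) g(a,c)
    ([courant_metric]). Together they give, for all sections X, Y, Z,
      g(N(X,Y),Z) = cyclic sum of g([tau X,tau Y],Z) - pr(tau X) g(tau Y,Z)
    ([nijenhuis_pairing]), and the right-hand side is
    - (d_E omega)(tau X,tau Y,tau Z) as soon as E is closed under brackets
    ([d_E_nijenhuis]).

    If N = 0, then [tau X,tau Y] lies in im tau = E, and d_E omega = 0 because
    every section e of E is tau X for X = - phi (tau (phi e)). If conversely E is
    closed and d_E omega = 0, the identity for Z = phi (N(X,Y)) reads
    G(N(X,Y),N(X,Y)) = 0. This choice of Z replaces an extension of tangent vectors
    to global sections by cut-off functions; in exchange N(X,Y) has to be a smooth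
    section, that is, Courant brackets of smooth sections have to be smooth
    ([smooth_courant]). At a point p the bracket is computed in the chart
    [chart_at p], which varies with p, so this amounts to its independence of the
    chart. For the Lie bracket that follows from the symmetry of the second
    derivatives of the changes of charts ([derive_derive_comm],
    [lie_bracket_chart]), and for the Lie derivative from its characterization
    by the Lie bracket ([lie_derivative_pairing]). *)

Set Implicit Arguments.
Unset Strict Implicit.
Unset Printing Implicit Defensive.

Import Order.TTheory GRing.Theory Num.Theory.
Import numFieldNormedType.Exports.

Local Open Scope classical_set_scope.
Local Open Scope ring_scope.

(** * Differentials and directional derivatives *)

Section Differentials.
Context {R : realType}.

Lemma near_eq_differentiable (V W : normedModType R) (f g : V -> W) (x : V) :
  (\near x, f x = g x) -> differentiable f x -> differentiable g x.
Proof.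
move=> fg df.
have fgx : f x = g x by exact: nbhs_singleton fg.
have gE : g \o shift x = cst (g x) + 'd f x +o_ 0 id.
  apply/eqaddoP => _/posnumP[e].
  have /eqaddoP/(_ e%:num (gt0 e)) := diff_locally df.
  have : \forall h \near (0 : V), f (h + x) = g (h + x).
    by move: fg; rewrite (near_shift 0 x); apply: filterS => h /=; rewrite subr0.
  apply: filterS2 => h /= fgh; rewrite !fctE /= fgh fgx; exact.
have dE : 'd g x = 'd f x :> (V -> W).
  by apply: diff_unique gE; exact: diff_continuous.
by apply/diff_locallyP; rewrite dE; split; [exact: diff_continuous|exact: gE].
Qed.

Lemma derive_line (V W : normedModType R) (f : V -> W) (y u : V) (s : R) :
  derivable f (s *: u + y) u ->
  is_derive s 1 (fun r : R => f (r *: u + y)) ('D_u f (s *: u + y)).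
Proof.
move=> df.
have E : (fun h : R => h^-1 *: (((fun r : R => f (r *: u + y)) \o shift s) (h *: 1)
      - f (s *: u + y))) =
   (fun h : R => h^-1 *: ((f \o shift (s *: u + y)) (h *: u) - f (s *: u + y))).
  by apply/funext => h /=; rewrite [h *: 1]mulr1 scalerDl addrA.
by split; [rewrite /derivable E | rewrite /derive E].
Qed.

Lemma derive_comp (U V W : normedModType R) (f : U -> V) (g : V -> W) x v :
  differentiable f x -> differentiable g (f x) ->
  'D_v (g \o f) x = 'D_('D_v f x) g (f x).
Proof.
move=> df dg; have dgf := differentiable_comp df dg.
by rewrite !deriveE // diff_comp.
Qed.

Lemma derive_linear (V W : normedModType R) (f : V -> W) x a u v :
  differentiable f x -> 'D_(a *: u + v) f x = a *: 'D_u f x + 'D_v f x.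
Proof. by move=> df; rewrite !deriveE // linearP. Qed.

Lemma derive_sub (V W : normedModType R) (f : V -> W) x u v :
  differentiable f x -> 'D_(u - v) f x = 'D_u f x - 'D_v f x.
Proof. by move=> df; rewrite !deriveE // linearB. Qed.

Lemma derive_basis n (W : normedModType R) (f : 'rV[R]_n -> W) x v :
  differentiable f x -> 'D_v f x = \sum_j v 0 j *: 'D_(delta_mx 0 j) f x.
Proof.
move=> df; rewrite deriveE // [X in 'd _ _ X]row_sum_delta linear_sum /=.
by apply: eq_bigr => j _; rewrite linearZ /= deriveE.
Qed.

Lemma differentiable_row (V : normedModType R) n (f : V -> 'rV[R]_n) x :
  (forall j, differentiable (fun y => f y 0 j) x) -> differentiable f x.
Proof.
move=> df.
have -> : f = \sum_(j < n) (fun y => f y 0 j *: (delta_mx 0 j : 'rV[R]_n)).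
  by apply/funext => y; rewrite fct_sumE [LHS]row_sum_delta.
by apply: differentiable_sum => j; apply: differentiableZl.
Qed.

Lemma differentiable_entry (V : normedModType R) n (f : V -> 'rV[R]_n) x j :
  differentiable f x -> differentiable (fun y => f y 0 j) x.
Proof.
move=> df; exact: (differentiable_comp df (differentiable_coord _ _ _)).
Qed.

Lemma derive_entry (V : normedModType R) n (f : V -> 'rV[R]_n) x v j :
  differentiable f x -> ('D_v f x) 0 j = 'D_v (fun y => f y 0 j) x.
Proof. by move=> df; rewrite derive_mx ?mxE //; exact: diff_derivable. Qed.

Lemma derive_sumE (V W : normedModType R) n (h : 'I_n -> V -> W) x v :
  (forall i, differentiable (h i) x) ->
  'D_v (fun y => \sum_i h i y) x = \sum_i 'D_v (h i) x.
Proof.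
move=> dh.
have -> : (fun y => \sum_i h i y) = \sum_i h i.
  by apply/funext => y; rewrite fct_sumE.
by rewrite derive_sum // => i; exact: diff_derivable.
Qed.

Lemma differentiable_sumE (V W : normedModType R) n (h : 'I_n -> V -> W) x :
  (forall i, differentiable (h i) x) ->
  differentiable (fun y => \sum_i h i y) x.
Proof.
move=> dh.
have -> : (fun y => \sum_i h i y) = \sum_i h i.
  by apply/funext => y; rewrite fct_sumE.
exact: differentiable_sum.
Qed.

Lemma derive_mulE (V : normedModType R) (f g : V -> R) x v :
  differentiable f x -> differentiable g x ->
  'D_v (fun y => f y * g y) x = f x * 'D_v g x + 'D_v f x * g x.
Proof.
move=> df dg; rewrite -[fun y => _]/(f * g) deriveM; try exact: diff_derivable.
by congr (_ + _); exact: mulrC.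
Qed.

End Differentials.

(** * Symmetry of second derivatives *)

Section Schwarz.
Context {R : realType} {V : normedModType R}.
Implicit Types (f : V -> R) (u v x : V).

(** The mean value theorem along u turns the second difference into t times
    the increment of 'D_u f under a displacement by t *: v, which is estimated by
    the differentiability of 'D_u f at x. *)
Lemma second_difference f u v x :
  (\forall y \near x, differentiable f y) -> differentiable ('D_u f) x ->
  forall e : R, 0 < e -> \forall t \near (0 : R)^'+,
    `|f (t *: u + (t *: v + x)) - f (t *: v + x) - f (t *: u + x) + f x
      - t ^+ 2 * 'D_v ('D_u f) x| <= e * t ^+ 2.
Proof.
move=> df dg e e0; set g := 'D_u f.
(* all the points involved lie at distance at most t * M from x *)
pose M := `|u| + `|v| + 1.
have M0 : 0 < M by rewrite /M ltr_wpDl // addr_ge0.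
(* two increments of 'D_u f are used, each up to e' * (t * M) *)
pose e' := e / (M + M).
have e'0 : 0 < e' by rewrite divr_gt0 // addr_gt0.
have /eqaddoP/(_ e' e'0)/nbhs_ballP[d1 /= d1_gt0 Hg] := diff_locally dg.
have : \forall h \near (0 : V), differentiable f (h + x).
  by move: df; rewrite (near_shift 0 x); apply: filterS => h /=; rewrite subr0.
move=> /nbhs_ballP[d2 /= d2_gt0 Hf].
near=> t.
have t0 : 0 < t by near: t; exact: nbhs_right_gt.
have tM (s r : R) : 0 <= s <= t -> 0 <= r <= t -> `|s *: u + r *: v| <= t * M.
  move=> /andP[s0 st] /andP[r0 rt]; apply: le_trans (ler_normD _ _) _.
  rewrite !normrZ !ger0_norm // /M !mulrDr mulr1 -[X in X <= _]addr0.
  by apply: lerD; [apply: lerD; rewrite ler_wpM2r|exact: ltW].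
have tM1 : t * M < d1.
  by rewrite -ltr_pdivlMr //; near: t; apply: nbhs_right_lt; rewrite divr_gt0.
have tM2 : t * M < d2.
  by rewrite -ltr_pdivlMr //; near: t; apply: nbhs_right_lt; rewrite divr_gt0.
have dfst s r : 0 <= s <= t -> 0 <= r <= t -> differentiable f (s *: u + (r *: v + x)).
  move=> hs hr; rewrite addrA; apply: Hf.
  by rewrite -ball_normE /= sub0r normrN (le_lt_trans _ tM2) // tM.
have t_t : 0 <= t <= t by rewrite lexx ltW.
have zt : 0 <= (0 : R) <= t by rewrite lexx ltW.
have dfs s : 0 <= s <= t -> differentiable f (s *: u + x).
  by move=> hs; have := dfst s 0 hs zt; rewrite scale0r add0r.
pose phi (s : R) := f (s *: u + (t *: v + x)) - f (s *: u + x).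
have dphi (s : R) : 0 <= s <= t ->
    is_derive s 1 phi (g (s *: u + (t *: v + x)) - g (s *: u + x)).
  move=> hs; apply: is_deriveB; apply: derive_line; apply: diff_derivable.
    exact: dfst.
  exact: dfs.
have dphi' (s : R) : s \in `]0, t[ ->
    is_derive s 1 phi (g (s *: u + (t *: v + x)) - g (s *: u + x)).
  by rewrite in_itv /= => /andP[s0 st]; apply: dphi; rewrite !ltW.
have cphi : {within `[0, t], continuous phi}.
  apply: derivable_within_continuous => s; rewrite in_itv /= => hs.
  by have [] := dphi s hs.
have [c] := MVT_segment (ltW t0) dphi' cphi.
rewrite in_itv /= => ct; rewrite /phi.
rewrite !scale0r !add0r subr0 opprB addrA => Edd.
have {}Edd : f (t *: u + (t *: v + x)) - f (t *: v + x) - f (t *: u + x) + f x =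
   (g (c *: u + (t *: v + x)) - g (c *: u + x)) * t.
  by rewrite -Edd; ring.
rewrite Edd.
have B (r : R) : 0 <= r <= t ->
    `|g (c *: u + (r *: v + x)) - (g x + ('d g x (c *: u) + r * 'd g x v))|
      <= e' * (t * M).
  have dE : 'd g x (c *: u + r *: v) = 'd g x (c *: u) + r * 'd g x v.
    by rewrite linearD; congr (_ + _); rewrite linearZ.
  move=> hr; have := Hg (c *: u + r *: v).
  rewrite /= !fctE /= dE -addrA => Hgr.
  apply: le_trans (Hgr _) _.
    by rewrite -ball_normE /= sub0r normrN (le_lt_trans _ tM1) // tM.
  by rewrite ler_wpM2l ?(ltW e'0) ?tM.
have B1 := B t t_t; have B0 := B 0 zt.
rewrite scale0r add0r mul0r addr0 in B0.
have Ee : e' * (t * M) + e' * (t * M) = e * t.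
  by rewrite /e'; field; rewrite gt_eqF // addr_gt0.
rewrite deriveE //.
set a1 := g (c *: u + _) in B1 *; set a0 := g (c *: u + x) in B0 *.
set dv := 'd g x v in B1 *; set du := 'd g x _ in B1 B0.
have -> : (a1 - a0) * t - t ^+ 2 * dv =
   t * ((a1 - (g x + (du + t * dv))) - (a0 - (g x + du))) by ring.
rewrite normrM gtr0_norm // expr2 mulrA [_ * t]mulrC ler_wpM2l ?(ltW t0) //.
by rewrite -Ee; apply: le_trans (ler_normB _ _) _; rewrite lerD.
Unshelve. all: by end_near. Qed.

(** The second difference is symmetric in u and v, so that both mixed
    derivatives approximate it up to o(t ^ 2). *)
Lemma derive_derive_comm f u v x :
  (\forall y \near x, differentiable f y) ->
  differentiable ('D_u f) x -> differentiable ('D_v f) x ->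
  'D_v ('D_u f) x = 'D_u ('D_v f) x.
Proof.
move=> df du dv; apply/eqP; rewrite -subr_eq0 -normr_le0; apply/ler_addgt0Pl => e e0.
rewrite addr0.
have e2 : 0 < e / 2 by rewrite divr_gt0.
have /(_ e2)Ha := @second_difference f u v x df du (e / 2).
have /(_ e2)Hb := @second_difference f v u x df dv (e / 2).
have [t [[A B] /= t0]] := filter_ex (filterI (filterI Ha Hb) (nbhs_right_gt 0)).
have t20 : 0 < t ^+ 2 by rewrite exprn_gt0.
rewrite [t *: v + (_ + _)]addrCA in B.
rewrite -(ler_pM2r t20) -[X in `|_| * X]gtr0_norm // -normrM.
move: (f (_ + _)) (f (_ + _)) (f (_ + _)) (f x) A B => p q r s.
move: ('D_v ('D_u f) x) ('D_u ('D_v f) x) => a b A B.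
have -> : (a - b) * t ^+ 2 = (r - p - q + s - t ^+ 2 * b)
    - (r - q - p + s - t ^+ 2 * a) by ring.
apply: le_trans (ler_normB _ _) _.
by rewrite [X in _ <= X * _]splitr mulrDl lerD.
Qed.

End Schwarz.

(** * Algebra of smooth functions *)

Section SmoothFunctions.
Context {R : realType} {n : nat}.
Implicit Types (U : set 'rV[R]_n) (f g : 'rV[R]_n -> R).

(** Iterated partial derivatives at x only depend on the germ at x. *)
Lemma smooth_on_near U f g :
  (forall x, U x -> \near x, f x = g x) -> smooth_on U f -> smooth_on U g.
Proof.
move=> fg sf s x Ux; apply: near_eq_differentiable (sf s x Ux).
elim: s x Ux {sf} => [|i s IH] x Ux /=; first exact: fg.
by have := near_join (IH x Ux); apply: filterS => y; exact: near_eq_derive.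
Qed.

Lemma smooth_on_ext U f g :
  open U -> (forall x, U x -> f x = g x) -> smooth_on U f -> smooth_on U g.
Proof.
move=> oU fg; apply: smooth_on_near => x Ux.
by apply: filterS (open_nbhs_nbhs (conj oU Ux)); exact: fg.
Qed.

Lemma smooth_on_sub U V f : V `<=` U -> smooth_on U f -> smooth_on V f.
Proof. by move=> VU sf s x /VU; exact: sf. Qed.

Lemma smooth_on_differentiable U f x :
  smooth_on U f -> U x -> differentiable f x.
Proof. by move=> sf; exact: (sf [::]). Qed.

Lemma smooth_on_partial U f i :
  smooth_on U f -> smooth_on U ('D_(delta_mx 0 i) f).
Proof. by move=> sf s x Ux; rewrite -foldr_rcons; exact: sf. Qed.

Lemma smooth_on_cst U (a : R) : smooth_on U (cst a).
Proof.
move=> s x _; suff [b ->] : exists b,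
    foldr (fun i (h : 'rV[R]_n -> R) => 'D_(delta_mx 0 i) h) (cst a) s = cst b.
  exact: differentiable_cst.
elim: s => [|i s [b IH]] /=; first by exists a.
by exists 0; rewrite IH; apply/funext => y; rewrite derive_cst.
Qed.

(** Derivatives up to order m only: the derivatives of f * g and of f^-1 are
    built from f * g and f^-1 again, so that closure properties are proved by
    induction on the order. *)
Definition smooth_upto (m : nat) U f := forall s : seq 'I_n, (size s <= m)%N ->
  forall x, U x -> differentiable
      (foldr (fun i (h : 'rV[R]_n -> R) => 'D_(delta_mx 0 i) h) f s) x.

Lemma smooth_uptoP U f : smooth_on U f <-> forall m, smooth_upto m U f.
Proof. by split=> [sf m s _|sf s]; [exact: sf|exact: (sf (size s))]. Qed.

Lemma smooth_uptoS m U f : smooth_upto m.+1 U f <->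
  (forall x, U x -> differentiable f x) /\
  forall i, smooth_upto m U ('D_(delta_mx 0 i) f).
Proof.
split=> [sf|[df sf]].
  split=> [|i s sm]; first exact: (sf [::]).
  by rewrite -foldr_rcons; apply: sf; rewrite size_rcons.
elim/last_ind => [_|s i _]; first exact: df.
by rewrite size_rcons ltnS foldr_rcons; exact: sf.
Qed.

Lemma smooth_uptoW m U f : smooth_upto m.+1 U f -> smooth_upto m U f.
Proof. by move=> sf s sm; apply: sf; exact: leqW. Qed.

Lemma smooth_upto_ext m U f g :
  open U -> (forall x, U x -> f x = g x) -> smooth_upto m U f -> smooth_upto m U g.
Proof.
move=> oU fg sf s sm x Ux; apply: near_eq_differentiable (sf s sm x Ux).
elim: s {sm} x Ux => [|i s IH] x Ux /=.
  by apply: filterS (open_nbhs_nbhs (conj oU Ux)); exact: fg.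
by have := near_join (IH x Ux); apply: filterS => y; exact: near_eq_derive.
Qed.

Lemma smooth_uptoD m U f g : open U ->
  smooth_upto m U f -> smooth_upto m U g ->
  smooth_upto m U (fun x => f x + g x).
Proof.
move=> oU; elim: m f g => [|m IH] f g sf sg.
  by move=> [|//] _ x Ux; apply: differentiableD; [exact: (sf [::])|exact: (sg [::])].
move: sf sg => /smooth_uptoS[df sf] /smooth_uptoS[dg sg]; apply/smooth_uptoS.
split=> [x Ux|i]; first by apply: differentiableD; [exact: df|exact: dg].
apply: (smooth_upto_ext (f := fun x => 'D_(delta_mx 0 i) f x + 'D_(delta_mx 0 i) g x)) => //.
  move=> x Ux; rewrite [RHS](@deriveD _ _ _ f g) //.
    by apply: diff_derivable; exact: df.
  by apply: diff_derivable; exact: dg.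
exact: IH.
Qed.

Lemma smooth_uptoM m U f g : open U ->
  smooth_upto m U f -> smooth_upto m U g ->
  smooth_upto m U (fun x => f x * g x).
Proof.
move=> oU; elim: m f g => [|m IH] f g sf sg.
  by move=> [|//] _ x Ux; apply: differentiableM; [exact: (sf [::])|exact: (sg [::])].
have sf' := smooth_uptoW sf; have sg' := smooth_uptoW sg.
move: sf sg => /smooth_uptoS[df sf] /smooth_uptoS[dg sg]; apply/smooth_uptoS.
split=> [x Ux|i]; first by apply: differentiableM; [exact: df|exact: dg].
apply: (smooth_upto_ext
  (f := fun x => f x * 'D_(delta_mx 0 i) g x + 'D_(delta_mx 0 i) f x * g x)) => //.
  by move=> x Ux; rewrite derive_mulE //; [exact: df|exact: dg].
by apply: smooth_uptoD => //; apply: IH.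
Qed.

Lemma smooth_onD U f g : open U ->
  smooth_on U f -> smooth_on U g -> smooth_on U (fun x => f x + g x).
Proof.
move=> oU /smooth_uptoP sf /smooth_uptoP sg; apply/smooth_uptoP => m.
exact: smooth_uptoD.
Qed.

Lemma smooth_onM U f g : open U ->
  smooth_on U f -> smooth_on U g -> smooth_on U (fun x => f x * g x).
Proof.
move=> oU /smooth_uptoP sf /smooth_uptoP sg; apply/smooth_uptoP => m.
exact: smooth_uptoM.
Qed.

Lemma smooth_onN U f : open U -> smooth_on U f -> smooth_on U (fun x => - f x).
Proof.
move=> oU sf; apply: (smooth_on_ext (f := fun x => -1 * f x)) => // [x _|].
  by rewrite mulN1r.
by apply: smooth_onM => //; exact: smooth_on_cst.
Qed.

Lemma smooth_onB U f g : open U ->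
  smooth_on U f -> smooth_on U g -> smooth_on U (fun x => f x - g x).
Proof. by move=> oU sf sg; apply: smooth_onD => //; exact: smooth_onN. Qed.

Lemma smooth_on_sum U (I : Type) (r : seq I) (P : pred I) (h : I -> 'rV[R]_n -> R) :
  open U -> (forall i, smooth_on U (h i)) ->
  smooth_on U (fun x => \sum_(i <- r | P i) h i x).
Proof.
move=> oU sh; elim: r => [|i r IH].
  apply: (smooth_on_ext (f := cst 0)) => // [x _|]; first by rewrite big_nil.
  exact: smooth_on_cst.
apply: (smooth_on_ext
  (f := fun x => (if P i then h i x else 0) + \sum_(j <- r | P j) h j x)) => //.
  by move=> x _; rewrite big_cons; case: (P i); rewrite ?add0r.
by apply: smooth_onD => //; case: (P i); [exact: sh|exact: smooth_on_cst].
Qed.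

Lemma smooth_on_prod U (I : Type) (r : seq I) (h : I -> 'rV[R]_n -> R) :
  open U -> (forall i, smooth_on U (h i)) ->
  smooth_on U (fun x => \prod_(i <- r) h i x).
Proof.
move=> oU sh; elim: r => [|i r IH].
  apply: (smooth_on_ext (f := cst 1)) => // [x _|]; first by rewrite big_nil.
  exact: smooth_on_cst.
apply: (smooth_on_ext (f := fun x => h i x * \prod_(j <- r) h j x)) => //.
  by move=> x _; rewrite big_cons.
exact: smooth_onM.
Qed.

Lemma smooth_onV U f : open U -> (forall x, U x -> f x != 0) ->
  smooth_on U f -> smooth_on U (fun x => (f x)^-1).
Proof.
move=> oU f0 sf; have df x : U x -> differentiable f x by exact: (sf [::]).
apply/smooth_uptoP; elim=> [|m IH].
  by move=> [|//] _ x Ux; apply: differentiableV; [exact: df|exact: f0].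
apply/smooth_uptoS; split=> [x Ux|i].
  by apply: differentiableV; [exact: df|exact: f0].
(* of lower order: (1/f)' = - f' * (1/f) ^ 2 *)
apply: (smooth_upto_ext
  (f := fun x => - 'D_(delta_mx 0 i) f x * ((f x)^-1 * (f x)^-1))) => //.
  move=> x Ux; rewrite deriveV ?f0 //; last by apply: diff_derivable; exact: df.
  by rewrite scaleNr mulNr expr2 invfM; congr (- _); exact: mulrC.
apply: smooth_uptoM => //; last exact: smooth_uptoM.
by move: m {IH}; apply/smooth_uptoP/smooth_onN => //; exact: smooth_on_partial.
Qed.

Lemma smooth_on_derive U f (v : 'rV[R]_n -> 'rV[R]_n) : open U ->
  smooth_on U f -> (forall j, smooth_on U (fun x => v x 0 j)) ->
  smooth_on U (fun x => 'D_(v x) f x).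
Proof.
move=> oU sf sv; apply: (smooth_on_ext
    (f := fun x => \sum_j v x 0 j * 'D_(delta_mx 0 j) f x)) => //.
  by move=> x Ux; rewrite derive_basis //; exact: (sf [::]).
apply: smooth_on_sum => // j; apply: smooth_onM => //.
exact: smooth_on_partial.
Qed.

End SmoothFunctions.

(** * Pairing of covectors and vectors *)

Section Pairing.
Context {R : realType} {n : nat}.
Implicit Types (a b : cotangent R n) (u v : tangent R n).

Lemma pairingDl a b v : pairing (a + b) v = pairing a v + pairing b v.
Proof. by rewrite -big_split; apply: eq_bigr => j _; rewrite mxE mulrDl. Qed.

Lemma pairingZl k a v : pairing (k *: a) v = k * pairing a v.
Proof. by rewrite big_distrr; apply: eq_bigr => j _; rewrite mxE /= mulrA. Qed.

Lemma pairingNl a v : pairing (- a) v = - pairing a v.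
Proof. by rewrite -scaleN1r pairingZl mulN1r. Qed.

Lemma pairingDr a u v : pairing a (u + v) = pairing a u + pairing a v.
Proof. by rewrite -big_split; apply: eq_bigr => j _; rewrite mxE mulrDr. Qed.

Lemma pairingZr k a v : pairing a (k *: v) = k * pairing a v.
Proof. by rewrite big_distrr; apply: eq_bigr => j _; rewrite mxE /= mulrCA. Qed.

Lemma pairingNr a v : pairing a (- v) = - pairing a v.
Proof. by rewrite -scaleN1r pairingZr mulN1r. Qed.

Lemma pairing0r a : pairing a 0 = 0.
Proof. by rewrite -(scale0r 0) pairingZr mul0r. Qed.

Lemma pairing_sumr a (I : Type) (r : seq I) (h : I -> tangent R n) :
  pairing a (\sum_(i <- r) h i) = \sum_(i <- r) pairing a (h i).
Proof.
by elim: r => [|i r IH]; rewrite ?big_nil ?pairing0r // !big_cons pairingDr IH.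
Qed.

Lemma pairing_delta a j : pairing a (delta_mx 0 j) = a 0 j.
Proof.
rewrite /pairing (bigD1 j) //= mxE !eqxx mulr1 big1 ?addr0 // => i ij.
by rewrite mxE (negPf ij) andbF mulr0.
Qed.

End Pairing.

(** * Charts and changes of charts *)

Section Charts.
Context {R : realType} {n : nat} {M : manifold R n}.
Implicit Types (c d : chart R n M) (p q : M).

Lemma chart_at_atlas p : atlas (chart_at p).
Proof. by rewrite /chart_at; case: cid2. Qed.

Lemma chart_at_dom p : chart_dom (chart_at p) p.
Proof. by rewrite /chart_at; case: cid2. Qed.

(** The transfer principle between M near p and 'rV_n near c p. *)
Lemma near_chart c p (U : set M) : chart_dom c p -> nbhs p U ->
  \forall x \near c p,
    [/\ U (chart_inv c x), chart_dom c (chart_inv c x) & c (chart_inv c x) = x].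
Proof.
move=> cp Up.
have icp : chart_inv c x @[x --> c p] --> chart_inv c (c p).
  exact: chart_inv_continuous cp.
rewrite chart_mapK // in icp.
have Ui : \forall x \near c p, U (chart_inv c x) := icp _ Up.
have Di : \forall x \near c p, chart_dom c (chart_inv c x) :=
  icp _ (open_nbhs_nbhs (conj (chart_dom_open c) cp)).
have Ii : nbhs (c p) (c @` chart_dom c).
  by apply: open_nbhs_nbhs; split; [exact: chart_img_open|exists p].
apply: filterS3 Ui Di Ii => x /= Ux Dx [q cq qx].
by split => //; move: qx => <-; rewrite chart_mapK.
Qed.

Lemma near_chart_dom c d p : chart_dom c p -> chart_dom d p ->
  \forall x \near c p, [/\ chart_dom d (chart_inv c x),
    chart_dom c (chart_inv c x) & c (chart_inv c x) = x].
Proof.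
move=> cp dp; apply: near_chart => //; apply: open_nbhs_nbhs; split => //.
exact: chart_dom_open.
Qed.

Lemma chart_image_open c (U : set M) : open U -> open (c @` (U `&` chart_dom c)).
Proof.
move=> oU; rewrite openE => x [p [Up cp] <-]; rewrite /interior.
have : nbhs p U by apply: open_nbhs_nbhs.
move=> /(near_chart cp); apply: filterS => y [Uy cy yy].
by exists (chart_inv c y).
Qed.

Definition transition c d : 'rV[R]_n -> 'rV[R]_n := d \o chart_inv c.

Lemma transition_smooth c d j : atlas c -> atlas d ->
  smooth_on (c @` (chart_dom c `&` chart_dom d)) (fun x => transition c d x 0 j).
Proof. by move=> ac ad; exact: atlas_compatible. Qed.

Lemma transition_differentiable c d p : atlas c -> atlas d ->
  chart_dom c p -> chart_dom d p -> differentiable (transition c d) (c p).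
Proof.
move=> ac ad cp dp; apply: differentiable_row => j.
by apply: (smooth_on_differentiable (transition_smooth _ ac ad)); exists p.
Qed.

Lemma transition_partial_differentiable c d p i j : atlas c -> atlas d ->
  chart_dom c p -> chart_dom d p ->
  differentiable ('D_(delta_mx 0 i) (fun x => transition c d x 0 j)) (c p).
Proof.
move=> ac ad cp dp; apply: smooth_on_differentiable.
  exact: (smooth_on_partial i (transition_smooth j ac ad)).
by exists p.
Qed.

Lemma transitionE c d p : chart_dom c p -> transition c d (c p) = d p.
Proof. by move=> cp; rewrite /transition /= chart_mapK. Qed.

(** The differential at p of the change of charts from c to d. Both [tcomp]
    and [cframe] are instances, with [chart_at p] as one of the charts. *)
Definition Dtrans c d p (v : 'rV[R]_n) := 'D_v (transition c d) (c p).

(** The chain rule for c -> d -> e. *)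
Lemma Dtrans_comp c d e p v : atlas c -> atlas d -> atlas e ->
  chart_dom c p -> chart_dom d p -> chart_dom e p ->
  Dtrans d e p (Dtrans c d p v) = Dtrans c e p v.
Proof.
move=> ac ad ae cp dp ep; rewrite /Dtrans -[in X in 'D_ _ _ X](transitionE d cp).
rewrite -derive_comp; first last.
- by rewrite transitionE //; exact: transition_differentiable.
- exact: transition_differentiable.
apply: near_eq_derive; have := near_chart_dom cp dp.
apply: filterS => x [dx cx xx].
by rewrite /transition /= chart_mapK.
Qed.

Lemma Dtrans_id c p v : chart_dom c p -> Dtrans c c p v = v.
Proof.
move=> cp; rewrite /Dtrans -[RHS](derive_id (c p) v).
apply: near_eq_derive; have := near_chart_dom cp cp.
by apply: filterS => x [].
Qed.

Lemma Dtrans_linear c d p k u v : atlas c -> atlas d ->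
  chart_dom c p -> chart_dom d p ->
  Dtrans c d p (k *: u + v) = k *: Dtrans c d p u + Dtrans c d p v.
Proof. by move=> *; apply: derive_linear; exact: transition_differentiable. Qed.

Lemma Dtrans_sub c d p u v : atlas c -> atlas d ->
  chart_dom c p -> chart_dom d p ->
  Dtrans c d p (u - v) = Dtrans c d p u - Dtrans c d p v.
Proof. by move=> *; apply: derive_sub; exact: transition_differentiable. Qed.

Lemma Dtrans_basis c d p v : atlas c -> atlas d ->
  chart_dom c p -> chart_dom d p ->
  Dtrans c d p v = \sum_j v 0 j *: Dtrans c d p (delta_mx 0 j).
Proof. by move=> *; apply: derive_basis; exact: transition_differentiable. Qed.

Lemma tcompE c p v : tcomp c p v = Dtrans (chart_at p) c p v.
Proof. by []. Qed.

Lemma cframeE c p j : cframe c p j = Dtrans c (chart_at p) p (delta_mx 0 j).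
Proof. by []. Qed.

Lemma tcomp_linear c p k u v : atlas c -> chart_dom c p ->
  tcomp c p (k *: u + v) = k *: tcomp c p u + tcomp c p v.
Proof.
by move=> ac cp; apply: Dtrans_linear => //; [exact: chart_at_atlas|exact: chart_at_dom].
Qed.

Lemma tcomp_at p v : tcomp (chart_at p) p v = v.
Proof. by apply: Dtrans_id; exact: chart_at_dom. Qed.

Lemma cframe_at p j : cframe (chart_at p) p j = delta_mx 0 j.
Proof. by apply: Dtrans_id; exact: chart_at_dom. Qed.

Lemma tcomp_change c d p v : atlas c -> atlas d ->
  chart_dom c p -> chart_dom d p ->
  tcomp d p v = Dtrans c d p (tcomp c p v).
Proof.
move=> ac ad cp dp; rewrite !tcompE Dtrans_comp //.
  exact: chart_at_atlas.
exact: chart_at_dom.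
Qed.

Lemma tcomp_cframe c d p j : atlas c -> atlas d ->
  chart_dom c p -> chart_dom d p ->
  tcomp d p (cframe c p j) = Dtrans c d p (delta_mx 0 j).
Proof.
move=> ac ad cp dp; rewrite tcompE cframeE Dtrans_comp //.
  exact: chart_at_atlas.
exact: chart_at_dom.
Qed.

Lemma cframe_expand c p v : atlas c -> chart_dom c p ->
  v = \sum_j tcomp c p v 0 j *: cframe c p j.
Proof.
move=> ac cp; rewrite -[LHS](tcomp_at p) (tcomp_change (c := c)) //.
- by rewrite Dtrans_basis //; [exact: chart_at_atlas|exact: chart_at_dom].
- exact: chart_at_atlas.
- exact: chart_at_dom.
Qed.

Lemma vrepE c X p : chart_dom c p -> vrep c X (c p) = tcomp c p (X p).
Proof. by move=> cp; rewrite /vrep chart_mapK. Qed.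

Lemma frepE c mu p j : chart_dom c p ->
  frep c mu (c p) 0 j = pairing (mu p) (cframe c p j).
Proof. by move=> cp; rewrite /frep mxE chart_mapK. Qed.

Lemma pairing_frep c mu p v : atlas c -> chart_dom c p ->
  pairing (mu p) v = pairing (frep c mu (c p)) (tcomp c p v).
Proof.
move=> ac cp; rewrite [in LHS](cframe_expand v ac cp) pairing_sumr.
by apply: eq_bigr => j _; rewrite pairingZr frepE // mulrC.
Qed.

Lemma vrep_at X p : vrep (chart_at p) X (chart_at p p) = X p.
Proof. by rewrite vrepE ?tcomp_at //; exact: chart_at_dom. Qed.

Lemma frep_at mu p : frep (chart_at p) mu (chart_at p p) = mu p.
Proof.
apply/rowP => j; rewrite frepE ?cframe_at ?pairing_delta //.
exact: chart_at_dom.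
Qed.

Lemma vrep_change c d X p i : atlas c -> atlas d ->
  chart_dom c p -> chart_dom d p ->
  \forall x \near c p, vrep d X (transition c d x) 0 i =
    \sum_j vrep c X x 0 j * 'D_(delta_mx 0 j) (fun y => transition c d y 0 i) x.
Proof.
move=> ac ad cp dp; have := near_chart_dom cp dp; apply: filterS => x [dx cx xx].
rewrite -[in LHS]xx transitionE // vrepE // (tcomp_change (c := c)) // -vrepE // xx.
rewrite /Dtrans xx derive_entry; last first.
  by rewrite -xx; exact: transition_differentiable.
rewrite derive_basis //; apply: differentiable_entry.
by rewrite -xx; exact: transition_differentiable.
Qed.

(** The components in d are combinations of those in c, with partial
    derivatives of the change of charts as coefficients. *)
Lemma vrep_differentiable_change c d X p : atlas c -> atlas d ->
  chart_dom c p -> chart_dom d p ->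
  differentiable (vrep c X) (c p) -> differentiable (vrep d X) (d p).
Proof.
move=> ac ad cp dp dX; apply: differentiable_row => i.
pose F x := \sum_j vrep c X x 0 j *
              'D_(delta_mx 0 j) (fun y => transition c d y 0 i) x.
have dT : differentiable (transition d c) (d p) by exact: transition_differentiable.
have dF : differentiable F (transition d c (d p)).
  rewrite transitionE //; apply: differentiable_sumE => j.
  apply: differentiableM; first exact: differentiable_entry.
  exact: transition_partial_differentiable.
apply: near_eq_differentiable (differentiable_comp dT dF).
have Tp : transition d c (d p) = c p by rewrite transitionE.
have : \forall x \near d p, vrep d X (transition c d (transition d c x)) 0 i =
    F (transition d c x).
  have Tc : transition d c x @[x --> d p] --> transition d c (d p).
    exact: differentiable_continuous dT.
  rewrite Tp in Tc; exact: (Tc _ (vrep_change X i ac ad cp dp)).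
have := near_chart_dom dp cp; apply: filterS2 => x [cx dx xx].
by rewrite /= => <-; congr (vrep d X _ 0 i); rewrite /transition /= chart_mapK.
Qed.

Lemma dirD_chart c p v (f : M -> R) : atlas c -> chart_dom c p ->
  differentiable (f \o chart_inv c) (c p) ->
  dirD p v f = 'D_(tcomp c p v) (f \o chart_inv c) (c p).
Proof.
move=> ac cp df; rewrite /dirD tcompE /Dtrans.
have pp := chart_at_dom p; have ap := chart_at_atlas p.
rewrite -[in RHS](transitionE c pp) -derive_comp.
- apply: near_eq_derive; have := near_chart_dom pp cp; apply: filterS.
  by move=> x [cx _ _] /=; rewrite chart_mapK.
- exact: transition_differentiable.
- by rewrite transitionE.
Qed.

(** The second derivative at c p of the i-th component of the change of
    charts, evaluated on v and w. *)
Definition transition_hessian c d p i (v w : 'rV[R]_n) : R :=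
  \sum_j v 0 j *
    'D_w ('D_(delta_mx 0 j) (fun x => transition c d x 0 i)) (c p).

(** For constant v the sum over j is 'D_w ('D_v g) with g the i-th component
    of the change of charts, and directional derivatives of g commute. *)
Lemma transition_hessian_sym c d p i (v w : 'rV[R]_n) : atlas c -> atlas d ->
  chart_dom c p -> chart_dom d p ->
  transition_hessian c d p i v w = transition_hessian c d p i w v.
Proof.
move=> ac ad cp dp; rewrite /transition_hessian.
pose g x := transition c d x 0 i.
have dg j : differentiable ('D_(delta_mx 0 j) g) (c p).
  exact: transition_partial_differentiable.
have ng : \forall x \near c p, differentiable g x.
  have := near_chart_dom cp dp; apply: filterS => x [dx cx xx].
  by apply: differentiable_entry; rewrite -xx; exact: transition_differentiable.
have near_u (u : 'rV[R]_n) : \forall x \near c p,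
    \sum_j u 0 j * 'D_(delta_mx 0 j) g x = 'D_u g x.
  by apply: filterS ng => x dgx; rewrite derive_basis.
have dsum (u : 'rV[R]_n) :
    differentiable (fun x => \sum_j u 0 j * 'D_(delta_mx 0 j) g x) (c p).
  apply: differentiable_sumE => j.
  by apply: differentiableM => //; exact: differentiable_cst.
have dD (u : 'rV[R]_n) : differentiable ('D_u g) (c p).
  exact: near_eq_differentiable (near_u u) (dsum u).
have DD (u z : 'rV[R]_n) : \sum_j u 0 j * 'D_z ('D_(delta_mx 0 j) g) (c p) =
    'D_z ('D_u g) (c p).
  rewrite -(near_eq_derive _ (near_u u)) derive_sumE; last first.
    by move=> j; apply: differentiableM => //; exact: differentiable_cst.
  apply: eq_bigr => j _; rewrite derive_mulE //.
  by rewrite derive_cst mul0r addr0.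
by have := derive_derive_comm ng (dD v) (dD w); rewrite -(DD v w) -(DD w v).
Qed.

(** Differentiating the transformation law of the components of a vector
    field gives, besides the tensorial term, a second derivative of the change of
    charts, which is symmetric in the field and in the direction. *)
Lemma derive_vrep_change c d X p (w : 'rV[R]_n) i : atlas c -> atlas d ->
  chart_dom c p -> chart_dom d p -> differentiable (vrep c X) (c p) ->
  'D_(Dtrans c d p w) (vrep d X) (d p) 0 i =
  Dtrans c d p ('D_w (vrep c X) (c p)) 0 i
  + transition_hessian c d p i (vrep c X (c p)) w.
Proof.
move=> ac ad cp dp dX; pose g x := transition c d x 0 i.
have dX' := vrep_differentiable_change ac ad cp dp dX.
have dT : differentiable (transition c d) (c p) by exact: transition_differentiable.
have dg : differentiable g (c p) by exact: differentiable_entry.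
have dgj j : differentiable ('D_(delta_mx 0 j) g) (c p).
  exact: transition_partial_differentiable.
rewrite derive_entry // -[in LHS](transitionE d cp) -derive_comp //; last first.
  by rewrite transitionE //; exact: differentiable_entry.
rewrite (near_eq_derive _ (vrep_change X i ac ad cp dp)) derive_sumE; last first.
  by move=> j; apply: differentiableM => //; exact: differentiable_entry.
rewrite {1}/Dtrans derive_entry // derive_basis // -big_split /=.
apply: eq_bigr => j _; rewrite derive_mulE //; last exact: differentiable_entry.
by rewrite addrC (derive_entry w j dX).
Qed.

End Charts.

Local Opaque derive.

(** * Lie and Courant brackets at a point *)

Section Brackets.
Context {R : realType} {n : nat} {M : manifold R n}.
Implicit Types (c d : chart R n M) (p q : M).

(** The coordinate formula for the bracket holds in every chart: the two
    second derivative terms of [derive_vrep_change] are equal, and they cancel in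
    the commutator. *)
Lemma lie_bracket_chart c X Y p : atlas c -> chart_dom c p ->
  differentiable (vrep c X) (c p) -> differentiable (vrep c Y) (c p) ->
  tcomp c p (lie_bracket X Y p) =
  'D_(vrep c X (c p)) (vrep c Y) (c p) - 'D_(vrep c Y (c p)) (vrep c X) (c p).
Proof.
move=> ac cp dX dY; set c0 := chart_at p.
have c0p : chart_dom c0 p := chart_at_dom p.
have ac0 : atlas c0 := chart_at_atlas p.
have dX0 := vrep_differentiable_change ac ac0 cp c0p dX.
have dY0 := vrep_differentiable_change ac ac0 cp c0p dY.
have EX := derive_vrep_change (Y p) _ ac0 ac c0p cp dX0.
have EY := derive_vrep_change (X p) _ ac0 ac c0p cp dY0.
rewrite (vrep_at X p) in EX; rewrite (vrep_at Y p) in EY.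
rewrite (vrepE X cp) (vrepE Y cp) !tcompE -/c0; apply/rowP => i.
have L : lie_bracket X Y p =
    'D_(X p) (vrep c0 Y) (c0 p) - 'D_(Y p) (vrep c0 X) (c0 p) by [].
rewrite L {L}.
rewrite (Dtrans_sub _ _ ac0 ac c0p cp).
rewrite [LHS]mxE [X in _ + X = _]mxE [in RHS]mxE [X in _ = _ + X]mxE.
apply: (etrans _ (esym (congr2 (fun a b : R => a - b) (EY i) (EX i)))).
rewrite (transition_hessian_sym i (Y p) (X p) ac0 ac c0p cp).
have subKK (a b h : R) : a - b = (a + h) - (b + h) by ring.
exact: subKK.
Qed.

(** Differentiability at p, read in the chart in which the brackets at p are
    computed. *)
Definition diff_fun (f : M -> R) p :=
  differentiable (f \o chart_inv (chart_at p)) (chart_at p p).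

Definition diff_vf (X : M -> tangent R n) p :=
  differentiable (vrep (chart_at p) X) (chart_at p p).

Definition diff_form (mu : M -> cotangent R n) p :=
  differentiable (frep (chart_at p) mu) (chart_at p p).

Lemma dirDD p v f g : diff_fun f p -> diff_fun g p ->
  dirD p v (fun q => f q + g q) = dirD p v f + dirD p v g.
Proof. by move=> df dg; apply: deriveD; exact: diff_derivable. Qed.

Lemma dirDN p v f : diff_fun f p ->
  dirD p v (fun q => - f q) = - dirD p v f.
Proof. by move=> df; apply: deriveN; exact: diff_derivable. Qed.

Lemma dirD_cst p v (k : R) : dirD p v (fun _ => k) = 0.
Proof. exact: derive_cst. Qed.

Lemma diff_funD p f g : diff_fun f p -> diff_fun g p ->
  diff_fun (fun q => f q + g q) p.
Proof. exact: differentiableD. Qed.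

Lemma diff_funN p f : diff_fun f p -> diff_fun (fun q => - f q) p.
Proof. exact: differentiableN. Qed.

Lemma pairing_chart c mu X p : atlas c -> chart_dom c p ->
  \forall x \near c p, \sum_j frep c mu x 0 j * vrep c X x 0 j =
     pairing (mu (chart_inv c x)) (X (chart_inv c x)).
Proof.
move=> ac cp; have := near_chart_dom cp cp; apply: filterS => x [_ cx xx].
by rewrite (pairing_frep mu _ ac cx) xx.
Qed.

Lemma diff_fun_pairing p mu X : diff_form mu p -> diff_vf X p ->
  diff_fun (fun q => pairing (mu q) (X q)) p.
Proof.
move=> dmu dX; rewrite /diff_fun.
apply: (near_eq_differentiable
  (pairing_chart mu X (chart_at_atlas p) (chart_at_dom p))).
by apply: differentiable_sumE => j; apply: differentiableM;
  exact: differentiable_entry.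
Qed.

Lemma dirD_pairing p v mu X : diff_form mu p -> diff_vf X p ->
  dirD p v (fun q => pairing (mu q) (X q)) =
  pairing (mu p) ('D_v (vrep (chart_at p) X) (chart_at p p))
  + pairing ('D_v (frep (chart_at p) mu) (chart_at p p)) (X p).
Proof.
move=> dmu dX; rewrite /dirD.
have N := pairing_chart mu X (chart_at_atlas p) (chart_at_dom p).
rewrite -(near_eq_derive v N) derive_sumE; last first.
  by move=> j; apply: differentiableM; exact: differentiable_entry.
rewrite -big_split; apply: eq_bigr => j _ /=.
rewrite derive_mulE; [|exact: differentiable_entry..].
by rewrite vrep_at frep_at !derive_entry.
Qed.

(** The Leibniz rule X (mu Z) = (L_X mu) Z + mu [X,Z], which determines
    L_X mu without coordinates. *)
Lemma lie_derivative_pairing p X mu Z :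
  diff_vf X p -> diff_form mu p -> diff_vf Z p ->
  pairing (lie_derivative X mu p) (Z p) =
  dirD p (X p) (fun q => pairing (mu q) (Z q)) - pairing (mu p) (lie_bracket X Z p).
Proof.
move=> dX dmu dZ; rewrite dirD_pairing // /lie_derivative /lie_bracket.
rewrite pairingDl pairingDr pairingNr.
set A := pairing (\row_j _) _.
have -> : A = pairing (mu p) ('D_(Z p) (vrep (chart_at p) X) (chart_at p p)).
  rewrite (derive_basis _ dX) pairing_sumr; apply: eq_bigr => j _.
  by rewrite mxE pairingZr mulrC.
have aux (a b d : R) : a + b = d + a - (d - b) by ring.
exact: aux.
Qed.

Lemma differential_pairing p f v : diff_fun f p ->
  pairing (differential f p) v = dirD p v f.
Proof.
move=> df; rewrite /dirD derive_basis //.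
by apply: eq_bigr => j _; rewrite mxE mulrC.
Qed.

Lemma lie_bracketC X Y p : lie_bracket Y X p = - lie_bracket X Y p.
Proof. by rewrite /lie_bracket opprB. Qed.

Definition diff_sec (s : M -> fiber R n) p :=
  diff_vf (fun q => (s q).1) p /\ diff_form (fun q => (s q).2) p.

Lemma diff_fun_neutral p s t : diff_sec s p -> diff_sec t p ->
  diff_fun (fun q => neutral (s q) (t q)) p.
Proof.
by move=> [s1 s2] [t1 t2]; apply: diff_funD; exact: diff_fun_pairing.
Qed.

(** The pairing of [a,b] with a third section involves only derivatives of
    functions and Lie brackets of vector fields, so that identities between such
    pairings become linear. *)
Lemma courant_pairing p a b s : diff_sec a p -> diff_sec b p -> diff_sec s p ->
  neutral (courant a b p) (s p) =
    dirD p (a p).1 (fun q => pairing (b q).2 (s q).1)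
  - pairing (b p).2 (lie_bracket (fun q => (a q).1) (fun q => (s q).1) p)
  - (dirD p (b p).1 (fun q => pairing (a q).2 (s q).1)
     - pairing (a p).2 (lie_bracket (fun q => (b q).1) (fun q => (s q).1) p))
  + 2^-1 * (dirD p (s p).1 (fun q => pairing (a q).2 (b q).1)
            - dirD p (s p).1 (fun q => pairing (b q).2 (a q).1))
  + pairing (s p).2 (lie_bracket (fun q => (a q).1) (fun q => (b q).1) p).
Proof.
move=> [a1 a2] [b1 b2] [s1 s2]; rewrite /neutral /courant /=.
have dab : diff_fun (fun q => pairing (a q).2 (b q).1) p by exact: diff_fun_pairing.
have dba : diff_fun (fun q => pairing (b q).2 (a q).1) p by exact: diff_fun_pairing.
rewrite 2!pairingDl pairingNl pairingZl; congr (_ - _ + _ * _ + _).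
- exact: (lie_derivative_pairing a1 b2 s1).
- exact: (lie_derivative_pairing b1 a2 s1).
rewrite differential_pairing; last by apply: diff_funD => //; exact: diff_funN.
by rewrite -(dirDN _ dba) -dirDD //; exact: diff_funN.
Qed.

Lemma courant_skew p a b s : diff_sec a p -> diff_sec b p -> diff_sec s p ->
  neutral (courant b a p) (s p) = - neutral (courant a b p) (s p).
Proof.
move=> da db ds; rewrite !courant_pairing //.
rewrite (lie_bracketC (fun q => (a q).1) (fun q => (b q).1)) pairingNr.
have aux (x p1 y p2 z1 z2 p3 : R) :
  y - p2 - (x - p1) + 2^-1 * (z2 - z1) - p3 =
  - (x - p1 - (y - p2) + 2^-1 * (z1 - z2) + p3) by ring.
exact: aux.
Qed.

(** An axiom of Courant algebroids. The Dorfman bracket a o b, which is [a,b]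
    plus half the differential of g(a,b), acts by derivations of g, that is,
    pr(a) g(b,s) = g(a o b,s) + g(b,a o s); the terms with 1/2 come from this
    correction of the bracket. *)
Lemma courant_metric p a b s : diff_sec a p -> diff_sec b p -> diff_sec s p ->
  dirD p (a p).1 (fun q => neutral (b q) (s q)) =
    neutral (courant a b p) (s p)
  + 2^-1 * dirD p (s p).1 (fun q => neutral (a q) (b q))
  + neutral (courant a s p) (b p)
  + 2^-1 * dirD p (b p).1 (fun q => neutral (a q) (s q)).
Proof.
move=> da db ds; rewrite !courant_pairing //.
move: da db ds => [a1 a2] [b1 b2] [s1 s2].
rewrite /neutral !dirDD; try exact: diff_fun_pairing.
rewrite (lie_bracketC (fun q => (b q).1) (fun q => (s q).1)) pairingNr.
have aux (x1 p1 y1 p2 z1 z2 p3 x2 w : R) : x1 + x2 =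
   (x1 - p1 - (y1 - p2) + 2^-1 * (z1 - z2) + p3) + 2^-1 * (z1 + z2)
   + (x2 - p3 - (z1 - - p2) + 2^-1 * (y1 - w) + p1) + 2^-1 * (y1 + w) by field.
exact: aux.
Qed.

Lemma smooth_vf_diff (U : set M) X p : open U -> U p -> smooth_vf U X -> diff_vf X p.
Proof.
move=> oU Up sX; apply: differentiable_row => j.
apply: (smooth_on_differentiable (sX _ (chart_at_atlas p) j)).
by exists p; split=> //; exact: chart_at_dom.
Qed.

Lemma smooth_form_diff (U : set M) mu p : open U -> U p -> smooth_form U mu ->
  diff_form mu p.
Proof.
move=> oU Up sX; apply: differentiable_row => j.
apply: (smooth_on_differentiable (sX _ (chart_at_atlas p) j)).
by exists p; split=> //; exact: chart_at_dom.
Qed.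

Lemma smooth_fun_diff (U : set M) f p : open U -> U p -> smooth_fun U f ->
  diff_fun f p.
Proof.
move=> oU Up sX.
apply: (smooth_on_differentiable (sX _ (chart_at_atlas p))).
by exists p; split=> //; exact: chart_at_dom.
Qed.

Lemma smooth_sec_diff (U : set M) s p : open U -> U p -> smooth_sec U s ->
  diff_sec s p.
Proof. by move=> oU Up [s1 s2]; split; [exact: smooth_vf_diff s1|exact: smooth_form_diff s2]. Qed.

End Brackets.

(** * Smoothness of sections and of their brackets *)

Section SmoothBrackets.
Context {R : realType} {n : nat} {M : manifold R n}.
Implicit Types (c d : chart R n M) (p q : M).

Lemma smooth_lie_bracket (U : set M) X Y : open U ->
  smooth_vf U X -> smooth_vf U Y -> smooth_vf U (lie_bracket X Y).
Proof.
move=> oU sX sY c ac j; have oV := chart_image_open (c := c) oU.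
have {}sX i := sX c ac i; have {}sY i := sY c ac i.
apply: (smooth_on_ext (f := fun x =>
   'D_(vrep c X x) (fun y => vrep c Y y 0 j) x
   - 'D_(vrep c Y x) (fun y => vrep c X y 0 j) x)) => //; last first.
  by apply: (smooth_onB oV); exact: (smooth_on_derive oV).
move=> _ [p [Up cp] <-].
have dX : differentiable (vrep c X) (c p).
  by apply: differentiable_row => i; apply: (smooth_on_differentiable (sX i)); exists p.
have dY : differentiable (vrep c Y) (c p).
  by apply: differentiable_row => i; apply: (smooth_on_differentiable (sY i)); exists p.
have subE (u v : 'rV[R]_n) : (u - v) 0 j = u 0 j - v 0 j by rewrite !mxE.
rewrite [in RHS](vrepE _ cp) (lie_bracket_chart ac cp dX dY).
by apply/esym/(etrans (subE _ _)); congr (_ - _); exact: derive_entry.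
Qed.

Lemma tcomp_cframe_at c p j : atlas c -> chart_dom c p ->
  tcomp c p (cframe c p j) = delta_mx 0 j.
Proof. by move=> ac cp; rewrite tcomp_cframe // Dtrans_id. Qed.

Lemma near_vrep_cframe c p j : atlas c -> chart_dom c p ->
  \forall x \near c p, delta_mx 0 j = vrep c (fun q => cframe c q j) x.
Proof.
move=> ac cp; have := near_chart_dom cp cp; apply: filterS => x [_ cx xx].
by rewrite -xx vrepE ?tcomp_cframe_at // chart_mapK.
Qed.

Lemma diff_vf_chart c X p : atlas c -> chart_dom c p ->
  differentiable (vrep c X) (c p) -> diff_vf X p.
Proof.
move=> ac cp; apply: vrep_differentiable_change => //.
  exact: chart_at_atlas.
exact: chart_at_dom.
Qed.

Lemma diff_vf_cframe c p j : atlas c -> chart_dom c p ->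
  diff_vf (fun q => cframe c q j) p.
Proof.
move=> ac cp; apply: (diff_vf_chart ac cp).
apply: near_eq_differentiable (near_vrep_cframe j ac cp) _.
exact: differentiable_cst.
Qed.

(** [lie_derivative_pairing] is applied to the j-th coordinate field Z of c.
    The components of Z in c are constant, so that [X,Z] is minus the j-th partial
    derivative of X; hence the coordinate formula for L_X mu holds in
    every chart. *)
Lemma frep_lie_derivative c X mu p j : atlas c -> chart_dom c p ->
  differentiable (vrep c X) (c p) -> differentiable (frep c mu) (c p) ->
  diff_form mu p ->
  frep c (lie_derivative X mu) (c p) 0 j =
    'D_(vrep c X (c p)) (fun y => frep c mu y 0 j) (c p)
    + \sum_i frep c mu (c p) 0 i *
        'D_(delta_mx 0 j) (fun y => vrep c X y 0 i) (c p).
Proof.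
move=> ac cp dX dmu dmup; rewrite (frepE _ _ cp).
have dZ := diff_vf_cframe j ac cp.
rewrite (lie_derivative_pairing (diff_vf_chart ac cp dX) dmup dZ).
have E : (fun q => pairing (mu q) (cframe c q j)) \o chart_inv c =
    fun y => frep c mu y 0 j.
  by apply/funext => y; rewrite /frep mxE.
congr (_ + _).
  rewrite (dirD_chart _ ac cp); first by rewrite E (vrepE _ cp).
  by rewrite E; exact: differentiable_entry.
rewrite (pairing_frep _ _ ac cp) (lie_bracket_chart ac cp) //; last first.
  apply: near_eq_differentiable (near_vrep_cframe j ac cp) _.
  exact: differentiable_cst.
rewrite -(near_eq_derive _ (near_vrep_cframe j ac cp)) derive_cst sub0r.
rewrite (vrepE _ cp) tcomp_cframe_at // pairingNr opprK.
by apply: eq_bigr => i _; rewrite derive_entry.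
Qed.

Lemma smooth_lie_derivative (U : set M) X mu : open U ->
  smooth_vf U X -> smooth_form U mu -> smooth_form U (lie_derivative X mu).
Proof.
move=> oU sX smu c ac j; have oV := chart_image_open (c := c) oU.
have smu' := smu; have {}sX i := sX c ac i; have {}smu i := smu c ac i.
apply: (smooth_on_ext (f := fun x =>
    'D_(vrep c X x) (fun y => frep c mu y 0 j) x
    + \sum_i frep c mu x 0 i *
        'D_(delta_mx 0 j) (fun y => vrep c X y 0 i) x)) => //; last first.
  apply: smooth_onD => //; first exact: smooth_on_derive.
  apply: smooth_on_sum => // i; apply: smooth_onM => //.
  exact: smooth_on_partial.
move=> _ [p [Up cp] <-].
have dX : differentiable (vrep c X) (c p).
  by apply: differentiable_row => i; apply: (smooth_on_differentiable (sX i)); exists p.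
have dmu : differentiable (frep c mu) (c p).
  by apply: differentiable_row => i; apply: (smooth_on_differentiable (smu i)); exists p.
rewrite (frep_lie_derivative j ac cp) //.
exact: smooth_form_diff smu'.
Qed.

Lemma smooth_differential (U : set M) f : open U ->
  smooth_fun U f -> smooth_form U (differential f).
Proof.
move=> oU sf c ac j; have oV := chart_image_open (c := c) oU.
apply: (smooth_on_ext (f := 'D_(delta_mx 0 j) (f \o chart_inv c))) => //; last first.
  by apply: smooth_on_partial; exact: sf.
move=> _ [p [Up cp] <-].
have df : differentiable (f \o chart_inv c) (c p).
  by apply: (smooth_on_differentiable (sf c ac)); exists p.
rewrite (frepE _ _ cp) differential_pairing; last exact: smooth_fun_diff sf.
by rewrite (dirD_chart _ ac cp) // tcomp_cframe_at.
Qed.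

Lemma smooth_pairing (U : set M) mu X : open U ->
  smooth_form U mu -> smooth_vf U X -> smooth_fun U (fun p => pairing (mu p) (X p)).
Proof.
move=> oU smu sX c ac; have oV := chart_image_open (c := c) oU.
apply: (smooth_on_ext
  (f := fun x => \sum_i frep c mu x 0 i * vrep c X x 0 i)) => //; last first.
  apply: smooth_on_sum => // i; apply: smooth_onM => //; [exact: smu|exact: sX].
move=> _ [p [Up cp] <-]; rewrite /= chart_mapK //.
by rewrite [RHS](pairing_frep _ _ ac cp) vrepE.
Qed.

Lemma vrep_linear c X Y (k : M -> R) p j : atlas c -> chart_dom c p ->
  vrep c (fun q => k q *: X q + Y q) (c p) 0 j =
  k p * vrep c X (c p) 0 j + vrep c Y (c p) 0 j.
Proof. by move=> ac cp; rewrite !vrepE // tcomp_linear // mxE [X in X + _]mxE. Qed.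

Lemma frep_linear c mu nu (k : M -> R) p j : chart_dom c p ->
  frep c (fun q => k q *: mu q + nu q) (c p) 0 j =
  k p * frep c mu (c p) 0 j + frep c nu (c p) 0 j.
Proof. by move=> cp; rewrite !frepE // pairingDl pairingZl. Qed.

Lemma smooth_vf_linear (U : set M) X Y k : open U -> smooth_fun U k ->
  smooth_vf U X -> smooth_vf U Y -> smooth_vf U (fun q => k q *: X q + Y q).
Proof.
move=> oU sk sX sY c ac j; have oV := chart_image_open (c := c) oU.
apply: (smooth_on_ext (f := fun x =>
   (k \o chart_inv c) x * vrep c X x 0 j + vrep c Y x 0 j)) => //; last first.
  apply: smooth_onD => //; last exact: sY.
  by apply: smooth_onM => //; [exact: sk|exact: sX].
by move=> _ [p [Up cp] <-]; rewrite vrep_linear //= chart_mapK.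
Qed.

Lemma smooth_form_linear (U : set M) mu nu k : open U -> smooth_fun U k ->
  smooth_form U mu -> smooth_form U nu ->
  smooth_form U (fun q => k q *: mu q + nu q).
Proof.
move=> oU sk sX sY c ac j; have oV := chart_image_open (c := c) oU.
apply: (smooth_on_ext (f := fun x =>
   (k \o chart_inv c) x * frep c mu x 0 j + frep c nu x 0 j)) => //; last first.
  apply: smooth_onD => //; last exact: sY.
  by apply: smooth_onM => //; [exact: sk|exact: sX].
by move=> _ [p [Up cp] <-]; rewrite frep_linear //= chart_mapK.
Qed.

Lemma smooth_sec_linear (U : set M) s t k : open U -> smooth_fun U k ->
  smooth_sec U s -> smooth_sec U t -> smooth_sec U (fun q => k q *: s q + t q).
Proof.
move=> oU sk [s1 s2] [t1 t2]; split.
  exact: (smooth_vf_linear oU sk s1 t1).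
exact: (smooth_form_linear oU sk s2 t2).
Qed.

Lemma smooth_fun_cst (U : set M) k : smooth_fun U (fun _ => k).
Proof.
move=> c ac; have -> : (fun _ : M => k) \o chart_inv c = cst k by [].
exact: smooth_on_cst.
Qed.

Lemma smooth_sec0 (U : set M) : open U -> smooth_sec U (fun _ => 0).
Proof.
move=> oU; split=> c ac j; apply: (smooth_on_ext (f := cst 0));
  [exact: chart_image_open| |exact: smooth_on_cst|exact: chart_image_open|
   |exact: smooth_on_cst] => _ [p [Up cp] <-] /=.
  rewrite vrepE //; have := tcomp_linear (-1) 0 0 ac cp.
  by rewrite scaler0 addr0 scaleN1r addNr => t0; rewrite [tcomp _ _ _]t0 mxE.
rewrite frepE //; have := pairingZl 0 0 (cframe c p j).
by rewrite scale0r mul0r => ->.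
Qed.

Lemma smooth_secD (U : set M) s t : open U ->
  smooth_sec U s -> smooth_sec U t -> smooth_sec U (fun q => s q + t q).
Proof.
move=> oU ss st.
have := smooth_sec_linear oU (smooth_fun_cst (U := U) 1) ss st.
by congr smooth_sec; apply/funext => q; rewrite scale1r.
Qed.

Lemma smooth_secZ (U : set M) s k : open U -> smooth_fun U k ->
  smooth_sec U s -> smooth_sec U (fun q => k q *: s q).
Proof.
move=> oU sk ss; have := smooth_sec_linear oU sk ss (smooth_sec0 oU).
by congr smooth_sec; apply/funext => q; rewrite addr0.
Qed.

Lemma smooth_secN (U : set M) s : open U ->
  smooth_sec U s -> smooth_sec U (fun q => - s q).
Proof.
move=> oU ss; have := smooth_secZ oU (smooth_fun_cst (U := U) (-1)) ss.
by congr smooth_sec; apply/funext => q; rewrite scaleN1r.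
Qed.

Lemma smooth_sec_sum (U : set M) (I : Type) (r : seq I) (s : I -> M -> fiber R n) :
  open U -> (forall i, smooth_sec U (s i)) ->
  smooth_sec U (fun q => \sum_(i <- r) s i q).
Proof.
move=> oU ss; elim: r => [|i r IH].
  have := smooth_sec0 oU.
  by congr smooth_sec; apply/funext => q; rewrite big_nil.
have := smooth_secD oU (ss i) IH.
by congr smooth_sec; apply/funext => q; rewrite big_cons.
Qed.

Lemma smooth_funB (U : set M) f g : open U ->
  smooth_fun U f -> smooth_fun U g -> smooth_fun U (fun p => f p - g p).
Proof.
move=> oU sf sg c ac.
by apply: smooth_onB; [exact: chart_image_open|exact: sf|exact: sg].
Qed.

Lemma smooth_courant (U : set M) s t : open U ->
  smooth_sec U s -> smooth_sec U t -> smooth_sec U (courant s t).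
Proof.
move=> oU [s1 s2] [t1 t2]; split; first exact: smooth_lie_bracket.
have L1 := smooth_lie_derivative oU s1 t2.
have L2 := smooth_lie_derivative oU t1 s2.
have D := smooth_differential oU
  (smooth_funB oU (smooth_pairing oU s2 t1) (smooth_pairing oU t2 s1)).
have A := smooth_form_linear oU (smooth_fun_cst (U := U) (-1)) L2 L1.
have := smooth_form_linear oU (smooth_fun_cst (U := U) (2^-1)) D A.
by congr smooth_form; apply/funext => q; rewrite scaleN1r addrC [- _ + _]addrC.
Qed.

Lemma smooth_vf_ext (U : set M) X Y : open U -> (forall p, U p -> X p = Y p) ->
  smooth_vf U X -> smooth_vf U Y.
Proof.
move=> oU XY sX c ac j; apply: smooth_on_ext (sX c ac j).
  exact: chart_image_open.
by move=> _ [p [Up cp] <-]; rewrite (vrepE X cp) (vrepE Y cp) XY.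
Qed.

Lemma smooth_form_ext (U : set M) mu nu : open U -> (forall p, U p -> mu p = nu p) ->
  smooth_form U mu -> smooth_form U nu.
Proof.
move=> oU XY sX c ac j; apply: smooth_on_ext (sX c ac j).
  exact: chart_image_open.
by move=> _ [p [Up cp] <-]; rewrite (frepE mu _ cp) (frepE nu _ cp) XY.
Qed.

Lemma smooth_sec_ext (U : set M) s t : open U -> (forall p, U p -> s p = t p) ->
  smooth_sec U s -> smooth_sec U t.
Proof.
move=> oU st [s1 s2]; split.
  by apply: smooth_vf_ext s1 => // p /st ->.
by apply: smooth_form_ext s2 => // p /st ->.
Qed.

Lemma smooth_sec_sub (U V : set M) s : V `<=` U -> smooth_sec U s -> smooth_sec V s.
Proof.
move=> VU [s1 s2]; split=> c ac j;
  [apply: smooth_on_sub (s1 c ac j)|apply: smooth_on_sub (s2 c ac j)];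
  by move=> _ [p [/VU Up cp] <-]; exists p.
Qed.

(** The condition that smoothness imposes at p only concerns the germ of s
    at p. *)
Lemma smooth_sec_local (U : set M) s :
  (forall p, U p -> exists2 V : set M, V p & smooth_sec V s) -> smooth_sec U s.
Proof.
move=> H; split=> c ac j m _ [p [Up cp] <-]; have [V Vp [s1 s2]] := H p Up.
  by apply: (s1 c ac j m); exists p.
by apply: (s2 c ac j m); exists p.
Qed.

End SmoothBrackets.

(** * Determinants, Gram matrices and orthogonal projections *)

Section SmoothDeterminants.
Context {R : realType} {n : nat} {M : manifold R n}.
Implicit Types (U : set M).

Lemma smooth_funM U (f g : M -> R) : open U ->
  smooth_fun U f -> smooth_fun U g -> smooth_fun U (fun p => f p * g p).
Proof.
move=> oU sf sg c ac.
by apply: smooth_onM; [exact: chart_image_open|exact: sf|exact: sg].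
Qed.

Lemma smooth_funV U (f : M -> R) : open U -> (forall p, U p -> f p != 0) ->
  smooth_fun U f -> smooth_fun U (fun p => (f p)^-1).
Proof.
move=> oU f0 sf c ac.
apply: smooth_onV; [exact: chart_image_open| |exact: sf].
by move=> _ [p [Up cp] <-] /=; rewrite chart_mapK //; exact: f0.
Qed.

Lemma smooth_fun_sum U (I : Type) (r : seq I) (f : I -> M -> R) : open U ->
  (forall i, smooth_fun U (f i)) -> smooth_fun U (fun p => \sum_(i <- r) f i p).
Proof.
move=> oU sf c ac; apply: (@smooth_on_sum _ _ _ I r predT (fun i => f i \o chart_inv c)).
  exact: chart_image_open.
by move=> i; exact: sf.
Qed.

Lemma smooth_fun_prod U (I : Type) (r : seq I) (f : I -> M -> R) : open U ->
  (forall i, smooth_fun U (f i)) -> smooth_fun U (fun p => \prod_(i <- r) f i p).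
Proof.
move=> oU sf c ac; apply: (@smooth_on_prod _ _ _ I r (fun i => f i \o chart_inv c)).
  exact: chart_image_open.
by move=> i; exact: sf.
Qed.

Lemma smooth_det U k (A : M -> 'M[R]_k) : open U ->
  (forall i j, smooth_fun U (fun p => A p i j)) ->
  smooth_fun U (fun p => \det (A p)).
Proof.
move=> oU sA; apply: smooth_fun_sum => // s.
apply: smooth_funM => //; first exact: smooth_fun_cst.
exact: smooth_fun_prod.
Qed.

(** Cramer's rule. *)
Lemma smooth_invmx U k (A : M -> 'M[R]_k) i j : open U ->
  (forall p, U p -> A p \in unitmx) ->
  (forall i j, smooth_fun U (fun p => A p i j)) ->
  smooth_fun U (fun p => invmx (A p) i j).
Proof.
move=> oU uA sA c ac; apply: (smooth_on_ext (f := fun x =>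
    ((fun p => (\det (A p))^-1 * cofactor (A p) j i) \o chart_inv c) x)).
- exact: chart_image_open.
- by move=> _ [p [Up cp] <-] /=; rewrite chart_mapK // /invmx uA // !mxE.
have : smooth_fun U (fun p => (\det (A p))^-1 * cofactor (A p) j i); last exact.
apply: smooth_funM => //.
  apply: smooth_funV => //; last exact: smooth_det.
  by move=> p /uA; rewrite unitmxE unitfE.
apply: smooth_funM => //; first exact: smooth_fun_cst.
apply: smooth_det => // i' j' c' ac'; apply: (smooth_on_ext (f :=
   (fun p => A p (lift j i') (lift i j')) \o chart_inv c')).
- exact: chart_image_open.
- by move=> _ [p [Up cp] <-] /=; rewrite !mxE.
exact: sA.
Qed.

End SmoothDeterminants.

Section OrthogonalProjection.
Context {R : realType} {V : vectType R} (g : V -> V -> R).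
Hypotheses (g_bilin : bilinear_for *%R *%R g) (g_sym : forall x y, g x y = g y x)
  (g_pos : forall x, x != 0 -> 0 < g x x).

Lemma inner_linear a x y z : g (a *: x + y) z = a * g x z + g y z.
Proof. by case: g_bilin => h _; exact: h. Qed.

Lemma inner0 z : g 0 z = 0.
Proof. by have := inner_linear (-1) 0 0 z; rewrite scaler0 addr0 mulN1r addNr. Qed.

Lemma innerZ a x z : g (a *: x) z = a * g x z.
Proof. by rewrite -[a *: x]addr0 inner_linear inner0 addr0. Qed.

Lemma innerD x y z : g (x + y) z = g x z + g y z.
Proof. by rewrite -[x]scale1r inner_linear mul1r scale1r. Qed.

Lemma innerN x z : g (- x) z = - g x z.
Proof. by rewrite -scaleN1r innerZ mulN1r. Qed.

Lemma inner_sum (I : Type) (r : seq I) (h : I -> V) z :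
  g (\sum_(i <- r) h i) z = \sum_(i <- r) g (h i) z.
Proof.
by elim: r => [|i r IH]; rewrite ?big_nil ?inner0 // !big_cons innerD IH.
Qed.

Lemma inner_eq0 x : g x x = 0 -> x = 0.
Proof.
move=> gx; apply/eqP/negP => /negP /g_pos.
by rewrite gx ltxx.
Qed.

Lemma inner_inj (E : {vspace V}) x y : x \in E -> y \in E ->
  (forall z, z \in E -> g x z = g y z) -> x = y.
Proof.
move=> xE yE xy; apply/eqP; rewrite -subr_eq0; apply/eqP/inner_eq0.
have zE : x - y \in E by rewrite rpredB.
by rewrite innerD innerN xy // subrr.
Qed.

Definition gram k (b : 'I_k -> V) : 'M[R]_k := \matrix_(i, j) g (b i) (b j).

Definition gram_proj k (b : 'I_k -> V) (y : V) : V :=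
  \sum_i (\sum_j invmx (gram b) i j * g y (b j)) *: b i.

Section Frame.
Variables (E : {vspace V}) (k : nat) (b : 'I_k -> V).
Hypothesis bE : basis_of E [tuple b i | i < k].

Lemma frame_mem i : b i \in E.
Proof.
have := basis_mem bE (_ : b i \in [tuple b i | i < k]); apply.
by apply/tnthP; exists i; rewrite tnth_mktuple.
Qed.

(** The entries of a row vector in the kernel of the Gram matrix are the
    coordinates of a vector of E that is orthogonal to E, hence to itself. *)
Lemma gram_unit : gram b \in unitmx.
Proof.
rewrite -row_free_unit -kermx_eq0; apply/rowV0P => v /sub_kermxP vA.
pose u := \sum_i v 0 i *: b i.
have gu j : g u (b j) = 0.
  have /rowP/(_ j) := vA; rewrite !mxE => <-; rewrite inner_sum.
  by apply: eq_bigr => i _; rewrite innerZ mxE.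
have u0 : u = 0.
  apply: inner_eq0; rewrite {1}/u inner_sum big1 // => i _.
  by rewrite innerZ g_sym gu mulr0.
have /freeP fb : free [tuple b i | i < k] := basis_free bE.
apply/rowP => i; rewrite mxE; apply: (fb (fun i => v 0 i)).
by rewrite -[RHS]u0; apply: eq_bigr => j _; rewrite -tnth_nth tnth_mktuple.
Qed.

Lemma gram_proj_mem y : gram_proj b y \in E.
Proof. by apply: rpred_sum => i _; apply: rpredZ; exact: frame_mem. Qed.

Lemma gram_projP y z : z \in E -> g (gram_proj b y) z = g y z.
Proof.
have gb m : g (gram_proj b y) (b m) = g y (b m).
  rewrite inner_sum.
  transitivity (\sum_j (gram b *m invmx (gram b)) m j * g y (b j)).
    under eq_bigr do rewrite innerZ big_distrl /=.
    rewrite exchange_big; apply: eq_bigr => j _ /=.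
    rewrite mxE big_distrl; apply: eq_bigr => i _ /=.
    by rewrite mxE (g_sym (b i)); ring.
  rewrite mulmxV ?gram_unit // (bigD1 m) //= mxE eqxx mul1r big1 ?addr0 // => j jm.
  by rewrite mxE eq_sym (negPf jm) mul0r.
move=> /(coord_basis bE) ->; rewrite [LHS]g_sym [RHS]g_sym !inner_sum.
apply: eq_bigr => i _; rewrite !innerZ -tnth_nth tnth_mktuple.
by rewrite g_sym gb [in RHS]g_sym.
Qed.

End Frame.

(** An arbitrary basis is used here; by [orth_projE] every frame gives the same
    vector, which is how the projection is seen to depend smoothly on the point. *)
Definition orth_proj (E : {vspace V}) : V -> V :=
  gram_proj (fun i : 'I_(\dim E) => (vbasis E)`_i).

Lemma vbasis_frame (E : {vspace V}) :
  basis_of E [tuple (vbasis E)`_i | i < \dim E].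
Proof.
have -> : [tuple (vbasis E)`_i | i < \dim E] = vbasis E :> seq V; last exact: vbasisP.
apply: (@eq_from_nth _ 0); rewrite ?size_tuple // => i iE.
by rewrite -[i]/(val (Ordinal iE)) -tnth_nth tnth_mktuple.
Qed.

Lemma orth_proj_mem E y : orth_proj E y \in E.
Proof. exact: gram_proj_mem (vbasis_frame E) _. Qed.

Lemma orth_projP (E : {vspace V}) y z : z \in E -> g (orth_proj E y) z = g y z.
Proof. exact: gram_projP (vbasis_frame E) _ _. Qed.

Lemma orth_projE (E : {vspace V}) k (b : 'I_k -> V) y : basis_of E [tuple b i | i < k] ->
  orth_proj E y = gram_proj b y.
Proof.
move=> bE; apply: (inner_inj (E := E)); rewrite ?orth_proj_mem ?(gram_proj_mem bE) //.
by move=> z zE; rewrite orth_projP // (gram_projP bE).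
Qed.

Lemma orth_proj_id (E : {vspace V}) y : y \in E -> orth_proj E y = y.
Proof.
move=> yE; apply: (inner_inj (E := E)) => //; first exact: orth_proj_mem.
exact: orth_projP.
Qed.

Lemma orth_proj_linear E : linear (orth_proj E).
Proof.
move=> a x y; apply: (inner_inj (E := E)).
- exact: orth_proj_mem.
- by rewrite rpredD ?rpredZ ?orth_proj_mem.
by move=> z zE; rewrite inner_linear !orth_projP // inner_linear.
Qed.

Lemma orth_proj_eq0 (E : {vspace V}) y : (forall z, z \in E -> g y z = 0) -> orth_proj E y = 0.
Proof.
move=> y0; apply: (inner_inj (E := E)); rewrite ?orth_proj_mem ?mem0v //.
by move=> z zE; rewrite orth_projP // y0 // inner0.
Qed.

End OrthogonalProjection.

Lemma linfunE (K : fieldType) (U V : vectType K) (f : U -> V) :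
  linear f -> linfun f =1 f.
Proof.
move=> lf; pose fM := GRing.isLinear.Build _ _ _ _ _ lf.
pose fL : {linear U -> V} := HB.pack f fM.
exact: (lfunE fL).
Qed.

Section Neutral.
Context {R : realType} {n : nat}.
Implicit Types (x y z : fiber R n).

Lemma neutralC x y : neutral x y = neutral y x.
Proof. exact: addrC. Qed.

Lemma neutralDl x y z : neutral (x + y) z = neutral x z + neutral y z.
Proof. by rewrite /neutral pairingDl pairingDr addrACA. Qed.

Lemma neutralZl a x z : neutral (a *: x) z = a * neutral x z.
Proof. by rewrite /neutral pairingZl pairingZr mulrDr. Qed.

Lemma neutralNl x z : neutral (- x) z = - neutral x z.
Proof. by rewrite -scaleN1r neutralZl mulN1r. Qed.

Lemma neutral0l z : neutral 0 z = 0.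
Proof. by rewrite -(scale0r 0) neutralZl mul0r. Qed.

End Neutral.

(** * Generalized metric 2-nilpotent structures *)

Section GeneralizedRiemannian.
Context {R : realType} {n : nat} {M : manifold R n}.
Variables (G : M -> fiber R n -> fiber R n -> R) (phi : M -> 'End(fiber R n)).
Hypothesis gr : gen_riemannian G phi.

Let gm := gen_metric gr.

Lemma phiK p x : phi p (phi p x) = x.
Proof. by have /lfunP/(_ x) := gen_phi_invol gr p; rewrite comp_lfunE id_lfunE. Qed.

Lemma neutralE p x y : neutral x y = G p (phi p x) y.
Proof. by rewrite (gen_metricE gr) phiK. Qed.

Lemma metric_phi p x y : G p (phi p x) (phi p y) = G p x y.
Proof. by rewrite !(gen_metricE gr) (gen_phi_isom gr). Qed.

Let GC p x y : G p x y = G p y x := metric_symmetric gm p x y.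
Let GN p x y : G p (- x) y = - G p x y := innerN (metric_bilinear gm p) x y.

Lemma metric_inj p (E : {vspace fiber R n}) x y : x \in E -> y \in E ->
  (forall z, z \in E -> G p x z = G p y z) -> x = y.
Proof.
exact: (inner_inj (metric_bilinear gm p) (@metric_pos_def _ _ _ _ gm p) (E := E)).
Qed.

Section TauLambda.
Variables (E : M -> {vspace fiber R n}) (tau : M -> 'End(fiber R n)).
Hypotheses (gt : gen_metric_2nilpotent G phi tau)
  (tauE : forall p, limg (tau p) = E p).

Let lam := tau_phi_restrE E phi tau.

Lemma tau_mem p x : tau p x \in E p.
Proof. by rewrite -tauE memv_img ?memvf. Qed.

Lemma tau_tau p x : tau p (tau p x) = 0.
Proof. by have /lfunP/(_ x) := tau_sqr0 gt.1 p; rewrite comp_lfunE zero_lfunE. Qed.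

Lemma neutral_tau p x y : neutral (tau p x) y = - neutral x (tau p y).
Proof. by apply/eqP; rewrite -addr_eq0 addrC (tau_skew gt.1). Qed.

Lemma val_tau_phi_restrE p x : vsval (lam p x) = tau p (phi p (vsval x)).
Proof.
rewrite linfunE; first by rewrite vsprojK ?tau_mem.
by move=> a u v; rewrite !linearP.
Qed.

Lemma tau_phi_isom p x y : x \in E p -> y \in E p ->
  G p (tau p (phi p x)) (tau p (phi p y)) = G p x y.
Proof.
move=> xE yE; rewrite gt.2 ?metric_phi //; apply: memv_img; rewrite tauE //.
Qed.

(** As G x y = g (phi x) y, this is the skewness of tau for g; on E it says
    that lam = tau \o phi is G-skew. *)
Lemma tau_phi_skew p x y : G p (tau p (phi p x)) y = - G p x (tau p (phi p y)).
Proof.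
by rewrite GC (gen_metricE gr) neutralC neutral_tau (gen_metricE gr).
Qed.

(** A skew isometry squares to -1: G (lam (lam x)) z = - G (lam x) (lam z). *)
Lemma tau_phi_sqr p x : x \in E p -> tau p (phi p (tau p (phi p x))) = - x.
Proof.
move=> xE; apply: (metric_inj (p := p) (E := E p)) => [||z zE].
- exact: tau_mem.
- by rewrite rpredN.
by rewrite tau_phi_skew tau_phi_isom // GN.
Qed.

Lemma tau_phi_complex_structure : complex_structure lam.
Proof.
split=> [U e oU se|p].
  have := tau_smooth gt.1 oU (gen_phi_smooth gr oU se).
  by congr smooth_sec; apply/funext => p; rewrite val_tau_phi_restrE.
apply/lfunP => x; apply/val_inj.
by rewrite comp_lfunE opp_lfunE id_lfunE /= -[LHS]/(vsval _) !val_tau_phi_restrE tau_phi_sqr ?subvsP.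
Qed.

Lemma tau_phi_compatible : lam_compatible G lam.
Proof. by move=> p x y; rewrite !val_tau_phi_restrE tau_phi_isom ?subvsP. Qed.

(** For z in E the right-hand side involves tau only through lam = tau \o phi,
    and tau x lies in E; hence lam determines tau. *)
Lemma metric_tau p x z :
  G p (tau p x) z = - neutral x (tau p (phi p z)).
Proof. by rewrite GC (gen_metricE gr) neutralC neutral_tau. Qed.

(** The left-hand side is omega u (tau y), because the fundamental form is
    omega u v = G (lam u) v. *)
Lemma omega_tau p u y : u \in E p ->
  G p (tau p (phi p u)) (tau p y) = neutral u y.
Proof.
move=> uE; rewrite (gen_metricE gr) neutralC neutral_tau tau_phi_sqr //.
by rewrite neutralC neutralNl opprK.
Qed.

(** * The Nijenhuis tensor and the fundamental form *)

Lemma smooth_tau s : smooth_sec setT s -> smooth_sec setT (fun q => tau q (s q)).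
Proof. exact: tau_smooth gt.1 _ _ openT. Qed.

Lemma diff_secT (s : M -> fiber R n) (p : M) : smooth_sec setT s -> diff_sec s p.
Proof. exact: smooth_sec_diff openT I. Qed.

(** Skewness of tau moves it to Z in the terms of N(X,Y). The resulting
    pairings are rewritten by [courant_metric] for the triples (tau Y, X, tau Z)
    and (tau X, Y, tau Z), where one term vanishes because im tau is isotropic. *)
Lemma nijenhuis_pairing s1 s2 s3 p :
  smooth_sec setT s1 -> smooth_sec setT s2 -> smooth_sec setT s3 ->
  let t1 q := tau q (s1 q) in
  let t2 q := tau q (s2 q) in
  let t3 q := tau q (s3 q) in
  neutral (nijenhuis tau s1 s2 p) (s3 p) =
  neutral (courant t1 t2 p) (s3 p) + neutral (courant t2 t3 p) (s1 p)
  + neutral (courant t3 t1 p) (s2 p)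
  - dirD p (t1 p).1 (fun q => neutral (t2 q) (s3 q))
  - dirD p (t2 p).1 (fun q => neutral (t3 q) (s1 q))
  - dirD p (t3 p).1 (fun q => neutral (t1 q) (s2 q)).
Proof.
have aux (K12 K23 K31 K13 A A' B F1 F2 F3 : R) :
  F2 = A + 2^-1 * - F3 + K23 + 2^-1 * 0 ->
  - F1 = B + 2^-1 * F3 + K13 + 2^-1 * 0 -> A' = - A -> K13 = - K31 ->
  K12 + A' + B = K12 + K23 + K31 - F1 - F2 - F3 by lra.
move=> ss1 ss2 ss3 t1 t2 t3.
have [d1 d2 d3] : [/\ diff_sec s1 p, diff_sec s2 p & diff_sec s3 p].
  by split; exact: diff_secT.
have [dt1 dt2 dt3] : [/\ diff_sec t1 p, diff_sec t2 p & diff_sec t3 p].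
  by split; apply/diff_secT/smooth_tau.
have t0 q x y : neutral (tau q x) (tau q y) = 0.
  by rewrite neutral_tau tau_tau neutralC neutral0l oppr0.
have NE : neutral (nijenhuis tau s1 s2 p) (s3 p) =
    neutral (courant t1 t2 p) (s3 p) + neutral (courant s1 t2 p) (t3 p)
    + neutral (courant t1 s2 p) (t3 p).
  have N_expand (a b c d z : fiber R n) :
      neutral (a - tau p b - tau p c + tau p (tau p d)) z =
      neutral a z + neutral b (tau p z) + neutral c (tau p z).
    by rewrite tau_tau addr0 !neutralDl !neutralNl !neutral_tau !opprK.
  exact: N_expand.
have E1 : (fun q => neutral (s1 q) (t3 q)) = (fun q => neutral (t3 q) (s1 q)).
  by apply/funext => q; rewrite neutralC.
have E2 : (fun q => neutral (t2 q) (s1 q)) = (fun q => - neutral (t1 q) (s2 q)).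
  by apply/funext => q; rewrite neutral_tau neutralC.
have E3 : (fun q => neutral (s2 q) (t3 q)) = (fun q => - neutral (t2 q) (s3 q)).
  by apply/funext => q; rewrite neutral_tau opprK.
have E4 : (fun q => neutral (t2 q) (t3 q)) = (fun q => 0).
  by apply/funext => q; rewrite t0.
have E5 : (fun q => neutral (t1 q) (t3 q)) = (fun q => 0).
  by apply/funext => q; rewrite t0.
have M1 := courant_metric dt2 d1 dt3.
rewrite E1 E2 E4 (dirDN _ (diff_fun_neutral dt1 d2)) dirD_cst in M1.
have M2 := courant_metric dt1 d2 dt3.
rewrite E3 E5 (dirDN _ (diff_fun_neutral dt2 d3)) dirD_cst in M2.
have S1 := courant_skew dt2 d1 dt3.
have S2 := courant_skew dt3 dt1 d2.
exact: etrans NE (aux _ _ _ _ _ _ _ _ _ _ M1 M2 S1 S2).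
Qed.

(** The fundamental form is unique because lam is invertible. *)
Lemma fundamental_formE w p (x y : subvs_of (E p)) s : fundamental_form G lam w ->
  vsval y = tau p s -> w p x y = neutral (vsval x) s.
Proof.
move=> [_ wE] ys; rewrite -(omega_tau (p := p)) ?subvsP // -ys.
(* omega x y = omega x (lam (- lam y)) = - G x (lam y) *)
have yE : y = lam p (- lam p y).
  apply: val_inj; rewrite [RHS]val_tau_phi_restrE [vsval (- _)]linearN !linearN /= val_tau_phi_restrE.
  by rewrite tau_phi_sqr ?opprK ?subvsP.
rewrite [in LHS]yE -wE [vsval (- _)]linearN /= val_tau_phi_restrE.
by rewrite GC GN GC tau_phi_skew.
Qed.

Lemma d_E_nijenhuis w s1 s2 s3 (e1 e2 e3 : secE E) p :
  fundamental_form G lam w -> courant_closed E ->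
  smooth_sec setT s1 -> smooth_sec setT s2 -> smooth_sec setT s3 ->
  (forall q, vsval (e1 q) = tau q (s1 q)) ->
  (forall q, vsval (e2 q) = tau q (s2 q)) ->
  (forall q, vsval (e3 q) = tau q (s3 q)) ->
  d_E w e1 e2 e3 p = - neutral (nijenhuis tau s1 s2 p) (s3 p).
Proof.
have aux (F1 F2 F3 K1 K2 K3 : R) :
  F1 + F2 + F3 - K1 - K2 - K3 = - (K1 + K2 + K3 - F1 - F2 - F3) by ring.
move=> fw cl ss1 ss2 ss3 es1 es2 es3.
have ev (a b : secE E) sa s : (forall q, vsval (a q) = tau q (sa q)) ->
    (forall q, vsval (b q) = tau q (s q)) ->
    (fun q => w q (a q) (b q)) = (fun q => neutral (tau q (sa q)) (s q)).
  by move=> asa bs; apply/funext => q; rewrite -asa; exact: fundamental_formE.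
have valE (a : secE E) s : (forall q, vsval (a q) = tau q (s q)) ->
    (fun q => vsval (a q)) = (fun q => tau q (s q)) by move=> ?; exact/funext.
have br (a b c : secE E) sa sb s :
    smooth_sec setT sa -> smooth_sec setT sb ->
    (forall q, vsval (a q) = tau q (sa q)) ->
    (forall q, vsval (b q) = tau q (sb q)) ->
    (forall q, vsval (c q) = tau q (s q)) ->
    w p (bracketE a b p) (c p) =
    neutral (courant (fun q => tau q (sa q)) (fun q => tau q (sb q)) p) (s p).
  move=> ssa ssb asa bsb cs; rewrite (fundamental_formE _ fw (cs p)).
  congr neutral; rewrite vsprojK; first by rewrite (valE a sa) ?(valE b sb).
  by apply: cl; rewrite /smooth_secE ?(valE a sa) ?(valE b sb) //; exact: smooth_tau.
rewrite /d_E /anchorE (ev e2 e3 s2 s3) // (ev e3 e1 s3 s1) // (ev e1 e2 s1 s2) //.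
rewrite (br e1 e2 e3 s1 s2 s3) // (br e2 e3 e1 s2 s3 s1) // (br e3 e1 e2 s3 s1 s2) //.
by rewrite nijenhuis_pairing // es1 es2 es3; exact: aux.
Qed.

Lemma smooth_nijenhuis s t : smooth_sec setT s -> smooth_sec setT t ->
  smooth_sec setT (nijenhuis tau s t).
Proof.
move=> ss st; have sts := smooth_tau ss; have stt := smooth_tau st.
apply: smooth_secD; [exact: openT| |]; last first.
  by do 2 apply: smooth_tau; exact: smooth_courant openT ss st.
apply: smooth_secD; [exact: openT| |]; last first.
  by apply: smooth_secN; [exact: openT|]; apply: smooth_tau; exact: smooth_courant openT sts st.
apply: smooth_secD; [exact: openT|exact: smooth_courant openT sts stt|].
by apply: smooth_secN; [exact: openT|]; apply: smooth_tau; exact: smooth_courant openT ss stt.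
Qed.

(** For s with values in E this is a preimage of s under tau, as
    - tau (phi (tau (phi s))) = - lam (lam s) = s. *)
Definition tau_lift (s : M -> fiber R n) q : fiber R n :=
  - phi q (tau q (phi q (s q))).

Lemma tau_liftK s q : s q \in E q -> tau q (tau_lift s q) = s q.
Proof. by move=> sE; rewrite linearN /= tau_phi_sqr // opprK. Qed.

Lemma smooth_tau_lift s : smooth_sec setT s -> smooth_sec setT (tau_lift s).
Proof.
move=> ss; apply: smooth_secN; first exact: openT.
by apply: (gen_phi_smooth gr openT); apply: smooth_tau; exact: gen_phi_smooth gr _ _ openT ss.
Qed.

Definition omega : formE E := fun p x y => G p (vsval (lam p x)) (vsval y).

Lemma omega_fundamental : fundamental_form G lam omega.
Proof.
split; last first.
  by move=> p x y; rewrite /omega tau_phi_compatible.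
have skew p x y : omega x y = - omega (p := p) y x.
  by rewrite /omega !val_tau_phi_restrE tau_phi_skew GC.
split=> [p|p x|U e1 e2 oU se1 se2].
- have lin a x y z : omega (p := p) (a *: x + y) z = a * omega x z + omega y z.
    by rewrite /omega !linearP (inner_linear (metric_bilinear gm p)).
  split=> y a x z; first exact: lin.
  by rewrite skew lin (skew _ x) (skew _ z) mulrN -opprD opprK.
- have eq_oppr0 (r : R) : r = - r -> r = 0 by lra.
  exact: eq_oppr0 (skew p x x).
- apply: (metric_smooth gm oU) => //; exact: complex_smooth tau_phi_complex_structure _ _ oU se1.
Qed.

Lemma tau_integrableP : tau_integrable tau <->
  courant_closed E /\ almost_kahler G lam.
Proof.
split=> [int|[cl [_ _ [w [fw dw]]]] s t ss st p].
  have cl : courant_closed E.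
    move=> e1 e2 se1 se2 p.
    have L1 := smooth_tau_lift se1; have L2 := smooth_tau_lift se2.
    have := int _ _ L1 L2 p; rewrite /nijenhuis tau_tau addr0.
    rewrite (_ : (fun q => tau q (tau_lift _ q)) = (fun q => vsval (e1 q))); last first.
      by apply/funext => q; rewrite tau_liftK ?subvsP.
    rewrite (_ : (fun q => tau q (tau_lift (fun p => vsval (e2 p)) q)) = (fun q => vsval (e2 q))); last first.
      by apply/funext => q; rewrite tau_liftK ?subvsP.
    move=> /eqP; rewrite -addrA -opprD subr_eq0 => /eqP ->.
    by rewrite rpredD ?tau_mem.
  split=> //; split; [exact: tau_phi_complex_structure|exact: tau_phi_compatible|].
  exists omega; split; first exact: omega_fundamental.
  move=> e1 e2 e3 se1 se2 se3 p.
  rewrite (d_E_nijenhuis (s1 := tau_lift (fun q => vsval (e1 q)))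
    (s2 := tau_lift (fun q => vsval (e2 q))) (s3 := tau_lift (fun q => vsval (e3 q))));
    try by move=> q; rewrite tau_liftK ?subvsP.
  - by rewrite int ?neutral0l ?oppr0 //; exact: smooth_tau_lift.
  - exact: omega_fundamental.
  - exact: cl.
  - exact: smooth_tau_lift.
  - exact: smooth_tau_lift.
  - exact: smooth_tau_lift.
pose N := nijenhuis tau s t.
have sN : smooth_sec setT N by exact: smooth_nijenhuis.
(* g N Z = G N N *)
pose Z q := phi q (N q).
have sZ : smooth_sec setT Z by exact: gen_phi_smooth gr _ _ openT sN.
pose e (r : M -> fiber R n) : secE E := fun q => vsproj (E q) (tau q (r q)).
have eE r q : vsval (e r q) = tau q (r q) by rewrite vsprojK ?tau_mem.
have se r : smooth_sec setT r -> smooth_secE setT (e r).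
  move=> sr; have := smooth_tau sr; rewrite /smooth_secE.
  by congr smooth_sec; apply/funext => q; rewrite eE.
have := dw _ _ _ (se _ ss) (se _ st) (se _ sZ) p.
rewrite (d_E_nijenhuis p fw cl ss st sZ (eE s) (eE t) (eE Z)).
move=> /eqP; rewrite oppr_eq0 neutralC -(gen_metricE gr) => /eqP.
exact: (inner_eq0 (@metric_pos_def _ _ _ _ gm p)).
Qed.

End TauLambda.

End GeneralizedRiemannian.

(** * From complex structures to 2-nilpotent structures *)

Section FromComplexStructure.
Context {R : realType} {n : nat} {M : manifold R n}.
Variables (G : M -> fiber R n -> fiber R n -> R) (phi : M -> 'End(fiber R n)).
Hypothesis gr : gen_riemannian G phi.
Variables (E : M -> {vspace fiber R n}) (k : nat).
Hypotheses (sb : subbundle k E) (iso : g_isotropic E).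
Variable lam : endE E.
Hypotheses (lc : complex_structure lam) (lg : lam_compatible G lam).

Let gm := gen_metric gr.
Let GC p x y : G p x y = G p y x := metric_symmetric gm p x y.
Let GN p x y : G p (- x) y = - G p x y := innerN (metric_bilinear gm p) x y.
Let bil p := metric_bilinear gm p.
Let pos p := @metric_pos_def _ _ _ _ gm p.

(** By [metric_tau] tau x has to be lam u, with u the vector of E such that
    G u z = g x z for all z in E; and g x z = G (phi x) z. *)
Definition lam_tau p : 'End(fiber R n) := linfun (fun x =>
  vsval (lam p (vsproj (E p) (orth_proj (G p) (E p) (phi p x))))).

Lemma lam_tauE p x : lam_tau p x =
  vsval (lam p (vsproj (E p) (orth_proj (G p) (E p) (phi p x)))).
Proof.
rewrite linfunE // => a u v.
by rewrite linearP (orth_proj_linear (bil p) (GC p) (@pos p)) !linearP.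
Qed.

Lemma lam_lam p x : lam p (lam p x) = - x.
Proof.
have /lfunP/(_ x) := complex_sqr lc p.
by rewrite comp_lfunE opp_lfunE id_lfunE.
Qed.

Lemma lam_skew_adjoint p (x y : subvs_of (E p)) :
  G p (vsval (lam p x)) (vsval y) = - G p (vsval x) (vsval (lam p y)).
Proof. by rewrite -lg lam_lam linearN GN. Qed.

Lemma vsproj_orth_proj p y : vsval (vsproj (E p) (orth_proj (G p) (E p) y)) =
  orth_proj (G p) (E p) y.
Proof. by rewrite vsprojK ?orth_proj_mem. Qed.

Lemma lam_tau_phi p x : x \in E p ->
  lam_tau p (phi p x) = vsval (lam p (vsproj (E p) x)).
Proof.
by move=> xE; rewrite lam_tauE (phiK gr) (orth_proj_id (bil p) (GC p) (@pos p)).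
Qed.

Lemma lam_tau_limg p : limg (lam_tau p) = E p.
Proof.
apply/vspaceP => x; apply/idP/idP => [/memv_imgP[y _ ->]|xE].
  by rewrite lam_tauE subvsP.
have -> : x = lam_tau p (phi p (vsval (lam p (- vsproj (E p) x)))).
  rewrite lam_tau_phi ?subvsP // vsvalK lam_lam opprK.
  by rewrite [RHS]vsprojK.
by rewrite memv_img ?memvf.
Qed.

Lemma lam_tau_skew p x y :
  neutral x (lam_tau p y) + neutral (lam_tau p x) y = 0.
Proof.
have E1 u v : neutral u (lam_tau p v) =
    G p (orth_proj (G p) (E p) (phi p u)) (lam_tau p v).
  rewrite (neutralE gr p) (orth_projP (bil p) (GC p) (@pos p)) //.
  by rewrite lam_tauE subvsP.
rewrite (neutralC (lam_tau p x)) !E1 !lam_tauE.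
move: (vsproj_orth_proj p (phi p x)) (vsproj_orth_proj p (phi p y)).
set u := vsproj _ _; set v := vsproj _ _ => <- <-.
by rewrite [X in _ + X]GC lam_skew_adjoint addrN.
Qed.

Lemma lam_tau_sqr p : (lam_tau p \o lam_tau p = 0)%VF.
Proof.
apply/lfunP => x; rewrite comp_lfunE zero_lfunE [LHS]lam_tauE.
rewrite (orth_proj_eq0 (bil p) (GC p) (@pos p)) ?linear0 // => z zE.
rewrite -(neutralE gr p); apply: (iso (p := p)) => //.
by rewrite lam_tauE subvsP.
Qed.

(** In a smooth local frame (e_i) of E, lam_tau s is the combination of the
    sections lam e_i whose coefficients come from the inverse Gram matrix. *)
Lemma lam_tau_smooth : smooth_end lam_tau.
Proof.
move=> U s oU ss; apply: smooth_sec_local => p Up.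
have [V [oV Vp [e [se eE]]]] := sb p.
pose W := U `&` V.
have oW : open W by exact: openI.
have WU : W `<=` U by move=> q [].
have WV : W `<=` V by move=> q [].
exists W; first by [].
pose c i q := \sum_j invmx (gram (G q) (fun i => e i q)) i j
                * G q (phi q (s q)) (e j q).
pose l i q := vsval (lam q (vsproj (E q) (e i q))).
have eq i : forall q, W q -> e i q \in E q.
  by move=> q [_ Vq]; exact: frame_mem (eE q Vq) i.
have sl i : smooth_sec W (l i).
  apply: (complex_smooth lc oW); rewrite /smooth_secE.
  apply: smooth_sec_ext (smooth_sec_sub WV (se i)) => // q Wq.
  by rewrite vsprojK ?eq.
have sGe i j : smooth_fun W (fun q => gram (G q) (fun i => e i q) i j).
  have := metric_smooth gm oW (smooth_sec_sub WV (se i)) (smooth_sec_sub WV (se j)).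
  by congr smooth_fun; apply/funext => q; rewrite mxE.
have sc i : smooth_fun W (c i).
  apply: smooth_fun_sum => // j; apply: smooth_funM => //.
    apply: smooth_invmx => // q [_ Vq].
    exact: gram_unit (bil q) (GC q) (@pos q) _ _ _ (eE q Vq).
  apply: (metric_smooth gm oW); last exact: smooth_sec_sub WV (se j).
  exact: (gen_phi_smooth gr oW (smooth_sec_sub WU ss)).
have := @smooth_sec_sum _ _ _ W _ (index_enum 'I_k) (fun i q => c i q *: l i q) oW
  (fun i => smooth_secZ oW (sc i) (sl i)).
apply: smooth_sec_ext => // q [Uq Vq].
rewrite lam_tauE (orth_projE (bil q) (GC q) (@pos q) _ (eE q Vq)).
by rewrite /gram_proj !linear_sum; apply: eq_bigr => i _; rewrite !linearZ.
Qed.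

Lemma lam_tau_2nilpotent : gen_metric_2nilpotent G phi lam_tau.
Proof.
split.
  split; [exact: lam_tau_smooth| |exact: lam_tau_sqr|exact: lam_tau_skew].
  exists k => p; rewrite lam_tau_limg; have [U [_ Up [e [_ eE]]]] := sb p.
  exact: size_basis (eE p Up).
move=> p _ _ /memv_imgP[x xE ->] /memv_imgP[y yE ->].
rewrite lam_tau_limg in xE yE; rewrite !lam_tau_phi // lg (metric_phi gr).
by rewrite !vsprojK.
Qed.

Lemma tau_phi_restrE_lam_tau : tau_phi_restrE E phi lam_tau = lam.
Proof.
apply/functional_extensionality_dep => p; apply/lfunP => x; apply: val_inj.
rewrite -[LHS]/(vsval _) (val_tau_phi_restrE phi lam_tau_limg) lam_tau_phi ?subvsP //.
by rewrite vsvalK.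
Qed.

End FromComplexStructure.

Unset Implicit Arguments.

Theorem proposition5p2 (R : realType) (n : nat) (M : manifold R n)
    (G : M -> fiber R n -> fiber R n -> R) (phi : M -> 'End(fiber R n))
    (E : M -> {vspace fiber R n}) (k : nat) :
  gen_riemannian G phi -> subbundle k E -> g_isotropic E ->
  set_bij
    [set tau | gen_metric_2nilpotent G phi tau /\
               (forall p, limg (tau p) = E p)]
    [set lam | complex_structure lam /\ lam_compatible G lam]
    (tau_phi_restrE E phi)
  /\
  (forall tau : M -> 'End(fiber R n),
    gen_metric_2nilpotent G phi tau -> (forall p, limg (tau p) = E p) ->
    (tau_integrable tau <->
     courant_closed E /\ almost_kahler G (tau_phi_restrE E phi tau))).
Proof.
move=> gr sb iso; split; last by move=> tau gt tauE; exact: tau_integrableP.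
split.
- move=> tau [gt tauE]; split; first exact: (tau_phi_complex_structure gr gt tauE).
  exact: (tau_phi_compatible gr gt tauE).
- move=> t1 t2; rewrite !inE => -[g1 E1] [g2 E2] eqlam.
  apply/funext => p; apply/lfunP => x.
  apply: (metric_inj gr (p := p) (E := E p)); [exact: tau_mem|exact: tau_mem|].
  move=> z zE; rewrite (metric_tau gr g1) (metric_tau gr g2); congr (- neutral x _).
  have := val_tau_phi_restrE phi E1 (vsproj (E p) z); rewrite vsprojK // => <-.
  have := val_tau_phi_restrE phi E2 (vsproj (E p) z); rewrite vsprojK // => <-.
  by rewrite eqlam.
- move=> lam [lc lg]; exists (lam_tau G phi lam).
    by split; [exact: lam_tau_2nilpotent|exact: lam_tau_limg].
  exact: tau_phi_restrE_lam_tau.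
Qed.
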